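(* Let $m,m'\in\mathbb Z\setminus\{0\}$, $\xi\in\mathbb Z_m$, $\xi'\in\mathbb Z_{m'}$. Then $\overline{BS}(m,\xi)$ and $\overline{BS}(m',\xi')$ are isomorphic as abstract groups if and only if there exist $\epsilon\in\{1,-1\}$ and a positive integer $d$ such that $m=\epsilon m'$, $d=\gcd(m,\xi)=\gcd(m',\xi')$, and the $m$-adic integers $\xi/d$ and $\epsilon\xi'/d$ have the same image under the canonical map $\mathbb Z_m\to\mathbb Z_{m/d}$. (Equivalently, for $m,m'>0$: $\widetilde{BS}(m,\xi)\cong\widetilde{BS}(m',\xi')$ iff $m=m'$ and $r_i(\xi)=r_i(\xi')$ for all $i\ge1$.)
   Context: $\mathbb Z_m$ is the ring of $m$-adic integers (note $\mathbb Z_m=\mathbb Z_{-m}$). For $n\in\mathbb Z,\xi\in\mathbb Z_m$, $\gcd(n,\xi)$ is the positive integer $d$ with $n\mathbb Z_m+\xi\mathbb Z_m=d\mathbb Z_m$; $\xi/d$ is well defined. For $p,q\in\mathbb Z\setminus\{0\}$, $BS(p,q)=\langle a,b\mid ab^pa^{-1}=b^q\rangle$, marked by $(a,b)$. $\mathcal G_2$ is the space of normal subgroups of $\mathbb F(a,b)$ with the ultrametric $d(N_1,N_2)=e^{-\lambda}$, $\lambda$ the minimal word length of an element of $N_1\triangle N_2$. $\overline{BS}(m,\xi)$ is the limit in $\mathcal G_2$ of $BS(m,\xi_n)$ for any sequence of integers $(\xi_n)$ with $|\xi_n|\to\infty$, $\xi_n\to\xi$ in $\mathbb Z_m$ (exists,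 independent of the sequence). The functions $r_i$: $r_0(\xi)=0$, $s_0(\xi)=1$, and for $i\ge1$, $r_i(\xi)\in\{0,\dots,|m|-1\}$, $s_i(\xi)\in\mathbb Z_m$ unique with $\xi s_{i-1}(\xi)=ms_i(\xi)+r_i(\xi)$. $\widetilde{BS}(m,\xi)=\langle E,a\mid axa^{-1}=\phi(x)\ \forall x\in E_{m,\xi}\rangle$ where $E$ is free abelian on $e_0,e_1,\dots$, $E_{m,\xi}$ has basis $me_0,\ e_i-r_i(\xi)e_0$ ($i\ge1$), and $\phi(me_0)=e_1$, $\phi(e_i-r_i(\xi)e_0)=e_{i+1}$. *)

(* Defs.v *)
From HB Require Import structures.
From mathcomp Require Import all_boot all_order all_algebra.
Set Implicit Arguments. Unset Strict Implicit. Unset Printing Implicit Defensive.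
Import Order.TTheory GRing.Theory Num.Theory.
Local Open Scope ring_scope.

(* Free group F(a,b): words over letters (is_b, positive_exponent).    *)
(* (false,true) = a, (false,false) = a^-1, (true,true) = b,            *)
(* (true,false) = b^-1.  Group elements = freely reduced words.        *)
Definition letter := (bool * bool)%type.
Definition word := seq letter.

Definition lflip (x : letter) : letter := (x.1, ~~ x.2).

Definition wreduce (w : word) : word :=
  foldr (fun x acc => match acc with
                      | y :: t => if y == lflip x then t else x :: acc
                      | [::] => [:: x]
                      end) [::] w.

Definition wreduced (w : word) : Prop := wreduce w = w.

Definition wmul (u v : word) : word := wreduce (u ++ v).
Definition winv (u : word) : word := wreduce (rev (map lflip u)).

Definition bpow (p : int) : word := nseq `|p|%N (true, 0 <= p).

Definition bs_relator (p q : int) : word :=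
  wreduce ([:: (false, true)] ++ bpow p ++ [:: (false, false)] ++ bpow (- q)).

Inductive nclos (r : word) : word -> Prop :=
  | nc_one : nclos r [::]
  | nc_conj g : nclos r (wmul g (wmul r (winv g)))
  | nc_mul u v : nclos r u -> nclos r v -> nclos r (wmul u v)
  | nc_inv u : nclos r u -> nclos r (winv u).

(* the kernel of F(a,b) -> BS(p,q), i.e. BS(p,q) as a marked group *)
Definition BSker (p q : int) : word -> Prop := nclos (bs_relator p q).

(* Convergence in the space of marked groups G_2:                      *)
(* d(N_n, N) -> 0, i.e. for every L, eventually N_n and N contain the  *)
(* same elements (reduced words) of length <= L.                       *)
Definition marked_conv (Ns : nat -> word -> Prop) (N : word -> Prop) : Prop :=
  forall L : nat, exists K : nat, forall n : nat, (K <= n)%N ->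
    forall w : word, wreduced w -> (size w <= L)%N -> (Ns n w <-> N w).

(* m-adic integers Z_m (M = |m|): coherent sequences x_k of integers   *)
(* (x_k taken mod M^k), up to congruence at every level.               *)
Definition is_adic (M : nat) (x : nat -> int) : Prop :=
  forall k : nat, (x k.+1 == x k %[mod (M%:Z) ^+ k])%Z.

Definition adic_eq (M : nat) (x y : nat -> int) : Prop :=
  forall k : nat, (x k == y k %[mod (M%:Z) ^+ k])%Z.

Definition adic_conv (M : nat) (s : nat -> int) (xi : nat -> int) : Prop :=
  forall k : nat, exists K : nat, forall n : nat, (K <= n)%N ->
    (s n == xi k %[mod (M%:Z) ^+ k])%Z.

Definition tends_infty (s : nat -> int) : Prop :=
  forall B : nat, exists K : nat, forall n : nat, (K <= n)%N -> (B <= `|s n|)%N.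

Definition adic_ideal_eq (M : nat) (n : int) (xi : nat -> int) (d : int) : Prop :=
  forall z, is_adic M z ->
    ((exists a b, is_adic M a /\ is_adic M b /\
                  adic_eq M z (fun k => n * a k + xi k * b k)) <->
     (exists c, is_adic M c /\ adic_eq M z (fun k => d * c k))).

Definition is_adic_gcd (m : int) (xi : nat -> int) (d : int) : Prop :=
  0 < d /\ (d %| m)%Z /\ adic_ideal_eq `|m|%N m xi d.

Definition is_barBS (m : int) (xi : nat -> int) (N : word -> Prop) : Prop :=
  exists s : nat -> int, tends_infty s /\ adic_conv `|m|%N s xi /\
    marked_conv (fun n => BSker m (s n)) N.

(* F(a,b)/N1 and F(a,b)/N2 are isomorphic as abstract groups:          *)
(* a map on representatives inducing a well-defined bijective          *)
(* homomorphism of the quotients.                                      *)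
Definition quot_iso (N1 N2 : word -> Prop) : Prop :=
  exists f : word -> word,
    (forall u v, N1 (wmul (winv u) v) -> N2 (wmul (winv (f u)) (f v))) /\
    (forall u v, N2 (wmul (winv (f (wmul u v))) (wmul (f u) (f v)))) /\
    (forall u v, N2 (wmul (winv (f u)) (f v)) -> N1 (wmul (winv u) v)) /\
    (forall v, exists u, N2 (wmul (winv (f u)) v)).

(* Main.v *)
(* Replacing (m, xi) by (-m, -xi) does not change the marked group, so let m > 0 and write
   r_i for the digits of xi.  The normal form algorithm in BS(m, s), for s large and close
   to xi, follows a formal algorithm on the HNN extension of E that only mentions m and
   the r_i (E is the lattice of polynomials spanned by e_0 = 1, e_1 = m X and
   e_(i+1) = X (e_i - r_i)); hence m and the r_i determine the limit as a marked group, and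
   any model of the relations [b, e_j] = 1 is a representation of the limit.

   Conversely let G -> G' be a surjection, A and B the images of a and b.  In the quotient
   Z wr Z of G', seen as the affine maps x -> X^n x + f, the relation [b, a b^m a^-1] = 1
   forces A and B to have a common fixed point unless B is a translation.  Surjectivity
   excludes the former, so B is a translation, by a unit eps X^l of Z[X, 1/X], and A has
   linear part X or 1/X.  Let H' be
   the normal closure of b in G'.  It maps to a Heisenberg group over Z, Q and Q/Z: the
   conjugate a^k b a^-k goes to a generator of the first kind for k = 0, to q_(k-1) in Q for
   k > 0 and to 0 for k < 0, where (q_i) are the coefficients of the inverse of the
   power series m' - sum_i r'_i S^i.  The image of [b, e_j] = 1 there says that, up to a
   shift, m q_(j-1) - sum_i r_i q_(j-1-i) is an integer for all j if A has linear part X,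
   and that m' divides m and all the r_i if it is 1/X.  In particular m' divides m; using
   both directions of an isomorphism, m = m' and then r_i = r'_i for all i.

   Finally, if d = gcd(m, xi), the digits of xi with respect to m are d times those of
   xi / d with respect to m / d, and the latter determine xi / d in Z_(m/d) because it
   is a unit there. *)
Require Import Defs.
From HB Require Import structures.
From mathcomp Require Import all_boot all_order all_algebra.
From mathcomp Require Import zify ring.
Set Implicit Arguments. Unset Strict Implicit. Unset Printing Implicit Defensive.
Import Order.TTheory GRing.Theory Num.Theory.
Local Open Scope ring_scope.

(** * Words and letter actions *)

Lemma lflipK : involutive lflip.
Proof. by case=> a b; rewrite /lflip /= negbK. Qed.

Definition invw (u : word) : word := rev (map lflip u).

Lemma invwK : involutive invw.
Proof.
move=> u; rewrite /invw map_rev revK -map_comp map_id_in // => x _ /=.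
exact: lflipK.
Qed.

Lemma invw_cat u v : invw (u ++ v) = invw v ++ invw u.
Proof. by rewrite /invw map_cat rev_cat. Qed.

Lemma invw_cons x u : invw (x :: u) = invw u ++ [:: lflip x].
Proof. by rewrite /invw /= rev_cons -cats1. Qed.

Definition run T (act : letter -> T -> T) (w : word) (x : T) : T := foldr act x w.

Lemma run_cat T (act : letter -> T -> T) u v x : run act (u ++ v) x = run act u (run act v x).
Proof. exact: foldr_cat. Qed.

(** The invariant [V] singles out the normalized states. Outside it, a letter followed by its
    inverse may change the state. *)
Definition letter_action T (V : T -> Prop) (act : letter -> T -> T) : Prop :=
  (forall x st, V st -> V (act x st)) /\
  (forall x st, V st -> act (lflip x) (act x st) = st).

Section Action.
Variables (T : Type) (V : T -> Prop) (act : letter -> T -> T).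
Hypothesis act_ok : letter_action V act.

Lemma run_valid w st : V st -> V (run act w st).
Proof. by move=> Vst; elim: w => //= x w; apply: (proj1 act_ok). Qed.

Lemma run_invwl w st : V st -> run act (invw w) (run act w st) = st.
Proof.
move=> Vst; elim: w => [//|x w IHw]; rewrite invw_cons run_cat /=.
by rewrite (proj2 act_ok) ?IHw //; apply: run_valid.
Qed.

Lemma run_invwr w st : V st -> run act w (run act (invw w) st) = st.
Proof. by move=> Vst; rewrite -{1}[w]invwK run_invwl. Qed.

Lemma run_wreduce w st : V st -> run act (wreduce w) st = run act w st.
Proof.
move=> Vst; elim: w => //= x w <-.
case: (wreduce w) => [//|y t]; case: eqP => [->|//] /=.
have /(proj2 act_ok (lflip x)) := run_valid t Vst.
by rewrite lflipK.
Qed.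

End Action.

(* Free reduction is itself an action, of the letters on reduced words. *)
Definition redact (x : letter) (acc : word) : word :=
  match acc with
  | y :: t => if y == lflip x then t else x :: acc
  | [::] => [:: x]
  end.

Lemma wreduce_run w : wreduce w = run redact w [::].
Proof. by []. Qed.

Definition irreducible_word (w : word) : bool := sorted (fun x y => y != lflip x) w.

Lemma redact_action : letter_action irreducible_word redact.
Proof.
split=> x [|y t] //=.
- by case: eqP => [-> /path_sorted //|/eqP yx] /=; rewrite yx.
- by rewrite lflipK eqxx.
- case: eqP => [->|/eqP yx pt] /=; last by rewrite lflipK eqxx.
  by case: t => [|z t] //=; rewrite lflipK; case: eqP.
Qed.

Lemma wreduce_catl u v : wreduce (wreduce u ++ v) = wreduce (u ++ v).
Proof.
rewrite !wreduce_run !run_cat; apply: (run_wreduce redact_action).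
exact: (run_valid redact_action).
Qed.

Lemma wreduce_catr u v : wreduce (u ++ wreduce v) = wreduce (u ++ v).
Proof. by rewrite !wreduce_run !run_cat (run_wreduce redact_action). Qed.

Lemma wreduceK w : wreduce (wreduce w) = wreduce w.
Proof. by have := wreduce_catl w [::]; rewrite !cats0. Qed.

Lemma wreduce_invwl u v : wreduce (u ++ invw u ++ v) = wreduce v.
Proof.
rewrite !wreduce_run !run_cat (run_invwr redact_action) //.
exact: (run_valid redact_action).
Qed.

Lemma wreduce_invwr u v : wreduce (invw u ++ u ++ v) = wreduce v.
Proof. by rewrite -{2}[u]invwK wreduce_invwl. Qed.

Lemma wreduce_invw u : wreduce (invw (wreduce u)) = wreduce (invw u).
Proof.
transitivity (wreduce (invw u ++ u ++ invw (wreduce u))); first by rewrite wreduce_invwr.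
rewrite -wreduce_catr -[wreduce (u ++ _)]wreduce_catl.
by have := wreduce_invwl (wreduce u) [::]; rewrite cats0 => ->; rewrite cats0.
Qed.

Lemma irreducible_run w st : irreducible_word st -> irreducible_word (run redact w st).
Proof. exact: (run_valid redact_action). Qed.

Lemma run_invw_wreduce u st : irreducible_word st ->
  run redact (invw (wreduce u)) st = run redact (invw u) st.
Proof.
move=> irr; rewrite -(run_wreduce redact_action) // wreduce_invw.
by rewrite (run_wreduce redact_action).
Qed.

(* Proves identities in the free group by letting both sides act on reduced words. *)
Ltac free_group := rewrite /wmul /winv;
  rewrite -?[rev (map lflip _)]/(invw _) [LHS]wreduce_run [RHS]wreduce_run;
  rewrite ?(run_cat, run_wreduce redact_action, run_invw_wreduce, invw_cat, invwK,
     run_invwl redact_action, run_invwr redact_action);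
  rewrite ?irreducible_run //.

(** * Congruences on words and the groups they define *)

Definition word_congruence (E : word -> word -> Prop) : Prop :=
  [/\ forall u, E u u, forall u v, E u v -> E v u,
      forall u v w, E u v -> E v w -> E u w,
      forall u u' v v', E u u' -> E v v' -> E (u ++ v) (u' ++ v')
    & forall x, E [:: x; lflip x] [::]].

Section Congruence.
Variable E : word -> word -> Prop.
Hypothesis congE : word_congruence E.

Lemma congr_refl u : E u u. Proof. by case: congE. Qed.
Lemma congr_sym u v : E u v -> E v u. Proof. case: congE => _ H _ _ _; exact: H. Qed.
Lemma congr_trans u v w : E u v -> E v w -> E u w.
Proof. case: congE => _ _ H _ _; exact: H. Qed.
Lemma congr_cat u u' v v' : E u u' -> E v v' -> E (u ++ v) (u' ++ v').
Proof. case: congE => _ _ _ H _; exact: H. Qed.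
Lemma congr_cons x v v' : E v v' -> E (x :: v) (x :: v').
Proof. by move=> H; apply: (@congr_cat [:: x] [:: x]) => //; apply: congr_refl. Qed.
Lemma congr_flip x v : E [:: x, lflip x & v] v.
Proof.
case: congE => _ _ _ _ H.
by apply: (@congr_cat [:: x; lflip x] [::] v v); [apply: H|apply: congr_refl].
Qed.

Lemma congr_wreduce w : E (wreduce w) w.
Proof.
elim: w => [|x w IHw]; first exact: congr_refl.
apply: congr_trans (congr_cons x IHw) => /=.
case: (wreduce w) => [|y t]; first exact: congr_refl.
by case: eqP => [->|_]; [apply/congr_sym/congr_flip|apply: congr_refl].
Qed.

Lemma congr_of_wreduce u v : wreduce u = wreduce v -> E u v.
Proof.
move=> e; apply: congr_trans (congr_wreduce v); rewrite -e.
exact/congr_sym/congr_wreduce.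
Qed.

Lemma congr_invwr u : E (u ++ invw u) [::].
Proof. by apply: congr_of_wreduce; have := wreduce_invwl u [::]; rewrite cats0. Qed.

Lemma congr_invwl u : E (invw u ++ u) [::].
Proof. by have := congr_invwr (invw u); rewrite invwK. Qed.

Lemma congr_invw u v : E u v -> E (invw u) (invw v).
Proof.
move=> uv; apply: (@congr_trans _ (invw u ++ v ++ invw v)).
  by rewrite -{1}[invw u]cats0; apply: congr_cat; [apply: congr_refl|apply/congr_sym/congr_invwr].
rewrite catA; apply: (@congr_cat _ [::] _ (invw v)); last exact: congr_refl.
apply: congr_trans (congr_invwl u); apply: congr_cat (congr_refl _) (congr_sym uv).
Qed.

Lemma congr_quotient u v : E (wmul (winv u) v) [::] <-> E u v.
Proof.
have red : E (wmul (winv u) v) (invw u ++ v).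
  by apply: congr_of_wreduce; rewrite /wmul /winv wreduceK wreduce_catl.
split=> H.
  have {}H : E (invw u ++ v) [::] by apply: congr_trans H; apply: congr_sym.
  apply: (@congr_trans _ (u ++ invw u ++ v)).
    by rewrite -{1}[u]cats0; apply: congr_cat; [apply: congr_refl|apply/congr_sym].
  by rewrite catA; apply: (@congr_cat _ [::]); [apply: congr_invwr|apply: congr_refl].
apply: congr_trans red _; apply: congr_trans (congr_invwl v).
by apply: congr_cat (congr_refl _); apply: congr_invw.
Qed.

End Congruence.

Definition bs_state := (int * seq (bool * int))%type.

(** * Normal forms in Baumslag-Solitar groups *)

(* The state [(c, [:: (e1, t1); (e2, t2); ...])] encodes the HNN normal form
   [b^c a^e1 b^t1 a^e2 b^t2 ...] of an element of BS(P true, P false); [K e c] is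
   the quotient of [c] by [P e], and the [t]'s are remainders. *)
Definition bs_step (P : bool -> int) (K : bool -> int -> int) (e : bool) (st : bs_state) :
    bs_state :=
  let k := K e st.1 in
  let r := st.1 - P e * k in
  match st.2 with
  | (e', t) :: l => if (r == 0) && (e' != e) then (P (~~ e) * k + t, l)
                    else (P (~~ e) * k, (e, r) :: st.2)
  | [::] => (P (~~ e) * k, (e, r) :: st.2)
  end.

Definition bs_act P K (x : letter) (st : bs_state) : bs_state :=
  if x.1 then (st.1 + (if x.2 then 1 else -1), st.2) else bs_step P K x.2 st.

(** These are the reduced normal forms of Britton: each [t] is its own remainder, and no letter
    [a^e] is followed, after [b^0], by its inverse. *)
Fixpoint normal_stack (K : bool -> int -> int) (l : seq (bool * int)) : bool :=
  match l with
  | (e, t) :: l' => [&& K e t == 0,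
      ~~ ((t == 0) && (if l' is (e', _) :: _ then e' != e else false)) & normal_stack K l']
  | [::] => true
  end.

Definition normal_state K (st : bs_state) : Prop := normal_stack K st.2.

Section Machine.
Variables (P : bool -> int) (K : bool -> int -> int).
Hypothesis KP : forall e (c : int), K e (c + P e) = K e c + 1.
Hypothesis K0 : forall e, K e 0 = 0.

Lemma KDmul e c j : K e (c + P e * j) = K e c + j.
Proof.
have KDnat n d : K e (d + P e * n%:Z) = K e d + n%:Z.
  elim: n => [|n IHn]; first by rewrite mulr0 !addr0.
  have -> : d + P e * n.+1%:Z = d + P e * n%:Z + P e by ring.
  by rewrite KP IHn; ring.
case: j => n; first exact: KDnat.
rewrite NegzE; apply: (addIr n.+1%:Z); rewrite -KDnat.
rewrite subrK; congr (K e _); ring.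
Qed.

Lemma KMD e j t : K e (P e * j + t) = j + K e t.
Proof. by rewrite addrC KDmul addrC. Qed.

Lemma Kmul e j : K e (P e * j) = j.
Proof. by rewrite -[P e * j]addr0 KMD K0 addr0. Qed.

(** This is the defining relation read on states. A multiple of [P e] crosses the letter as the same
    multiple of [P (~~ e)], without affecting the remainder. *)
Lemma bs_step_shift e c l j :
  bs_step P K e (c + P e * j, l) =
  ((bs_step P K e (c, l)).1 + P (~~ e) * j, (bs_step P K e (c, l)).2).
Proof.
rewrite /bs_step /= KDmul.
have -> : c + P e * j - P e * (K e c + j) = c - P e * K e c by ring.
by case: l => [|[e' t] l] /=; [|case: ifP => _ /=]; congr pair; ring.
Qed.

Lemma bs_step_normal e st : normal_state K st -> normal_state K (bs_step P K e st).
Proof.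
case: st => c l; rewrite /normal_state /bs_step /= => nl.
have Kr : K e (c - P e * K e c) = 0 by rewrite -mulrN KDmul subrr.
case: l nl => [|[e' t] l] nl /=; first by rewrite Kr eqxx andbF.
case: ifP => [_|nr] /=; first by case/and3P: nl.
by rewrite Kr eqxx nr.
Qed.

Lemma bs_stepK e st : normal_state K st -> bs_step P K (~~ e) (bs_step P K e st) = st.
Proof.
case: st => c l; rewrite /normal_state /= => nl.
rewrite {2}/bs_step /=; set k := K e c; set r := c - P e * k.
(* If the letter was pushed, its inverse meets the remainder zero and pops it again. *)
have push : bs_step P K (~~ e) (P (~~ e) * k, (e, r) :: l) = (c, l).
  by rewrite /bs_step /= Kmul subrr eqxx negbK /r; case: (e); rewrite /= addrC subrK.
case: l nl push => [//|[e' t] l] /= /and3P[/eqP Kt nt nl] push.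
case: ifP => // /andP[/eqP r0]; move: Kt nt.
have [->|->] : e' = ~~ e \/ e' = e by case: (e); case: (e'); auto.
  2: by rewrite eqxx.
move=> Kt nt _; rewrite /bs_step /= KMD Kt addr0 negbK addrAC subrr add0r.
have -> : P e * k = c by apply/esym/eqP; rewrite -subr_eq0 -/r r0.
(* If the letter was cancelled, its inverse pushes the erased entry back; normality of the original
   stack prevents a further cancellation with the next entry. *)
clear push; case: l nl nt => [//|[e2 s] l] _ /negPf nt.
by rewrite nt.
Qed.

Lemma bs_action : letter_action (normal_state K) (bs_act P K).
Proof.
split=> [[[] s] st nst|[[] s] [c l] nst]; rewrite /bs_act //=.
- exact: bs_step_normal.
- by case: s; rewrite ?addrK ?subrK.
- exact: bs_stepK.
Qed.

Lemma run_bpow j st : run (bs_act P K) (bpow j) st = (st.1 + j, st.2).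
Proof.
have run_nseq n s : run (bs_act P K) (nseq n (true, s)) st =
    (st.1 + n%:Z * (if s then 1 else -1), st.2).
  elim: n => [|n IHn] /=; first by rewrite mul0r addr0 -surjective_pairing.
  by rewrite IHn /bs_act /=; congr pair; lia.
by rewrite /bpow run_nseq; congr pair; case: (lerP 0 j) => H; lia.
Qed.

End Machine.

(** * Normal closures and the word problem in Baumslag-Solitar groups *)

Section NormalClosure.
Variable r : word.

Definition ncl_congr (u v : word) : Prop := nclos r (wreduce (u ++ invw v)).

(** The inductive clauses only conjugate the relator itself; conjugation distributes over the
    products and inverses. *)
Lemma nclosJ u g : nclos r u -> nclos r (wreduce (g ++ u ++ invw g)).
Proof.
move=> nu; elim: nu g => [|h|{}u v _ IHu _ IHv|{}u _ IHu] g.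
- by rewrite -[invw g]cats0 wreduce_invwl; apply: nc_one.
- have -> : wreduce (g ++ wmul h (wmul r (winv h)) ++ invw g)
      = wmul (g ++ h) (wmul r (winv (g ++ h))) by free_group.
  exact: nc_conj.
- have -> : wreduce (g ++ wmul u v ++ invw g)
      = wmul (wreduce (g ++ u ++ invw g)) (wreduce (g ++ v ++ invw g)) by free_group.
  exact: nc_mul.
- have -> : wreduce (g ++ winv u ++ invw g) = winv (wreduce (g ++ u ++ invw g)) by free_group.
  exact: nc_inv.
Qed.

Lemma nclos_wreduceJ u g : nclos r (wreduce u) -> nclos r (wreduce (g ++ u ++ invw g)).
Proof.
move=> /(nclosJ g).
have -> // : wreduce (g ++ wreduce u ++ invw g) = wreduce (g ++ u ++ invw g) by free_group.
Qed.

Lemma ncl_congr_congruence : word_congruence ncl_congr.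
Proof.
rewrite /ncl_congr; split.
- move=> u; have -> : wreduce (u ++ invw u) = wreduce [::] by free_group.
  exact: nc_one.
- move=> u v /nc_inv.
  by have -> : winv (wreduce (u ++ invw v)) = wreduce (v ++ invw u) by free_group.
- move=> u v w uv vw; have := nc_mul uv vw.
  by have -> : wmul (wreduce (u ++ invw v)) (wreduce (v ++ invw w)) = wreduce (u ++ invw w)
    by free_group.
- move=> u u' v v' uu vv; have := nc_mul (nclos_wreduceJ u vv) uu.
  by have -> : wmul (wreduce (u ++ (v ++ invw v') ++ invw u)) (wreduce (u ++ invw u'))
    = wreduce ((u ++ v) ++ invw (u' ++ v')) by free_group.
- by move=> x; rewrite cats0 /= eqxx; apply: nc_one.
Qed.

Lemma ncl_congr1 w : ncl_congr w [::] <-> nclos r (wreduce w).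
Proof. by rewrite /ncl_congr cats0. Qed.

Lemma ncl_congr_relator : ncl_congr r [::].
Proof. by have := nc_conj r [::]; rewrite /wmul /= wreduceK cats0 ncl_congr1. Qed.

Lemma nclos_run T (V : T -> Prop) (act : letter -> T -> T) : letter_action V act ->
  (forall st, V st -> run act r st = st) ->
  forall w, nclos r w -> forall st, V st -> run act w st = st.
Proof.
move=> aP rP w; elim=> {w} [//|g|u v _ IHu _ IHv|u _ IHu] st Vst.
- rewrite /wmul /winv -/(invw g) (run_wreduce aP) // run_cat (run_wreduce aP) // run_cat.
  by rewrite !(run_wreduce aP) // rP ?(run_invwr aP) //; apply: (run_valid aP).
- by rewrite /wmul (run_wreduce aP) // run_cat IHv // IHu.
- rewrite /winv -/(invw u) (run_wreduce aP) //.
  by rewrite -{1}(IHu st Vst) (run_invwl aP).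
Qed.

End NormalClosure.

Definition aw : word := [:: (false, true)].
Definition Aw : word := [:: (false, false)].

Section BaumslagSolitar.
Variables (p q eps : int) (P : bool -> int) (K : bool -> int -> int).
Hypothesis epsE : eps = 1 \/ eps = -1.
Hypothesis PE : forall e, P e = eps * (if e then p else q).
Hypothesis KP : forall e (c : int), K e (c + P e) = K e c + 1.
Hypothesis K0 : forall e, K e 0 = 0.

Let eps2 : eps * eps = 1. Proof. by case: epsE => ->. Qed.

(** Read from the right, the relator applies the step of [a^-1] and that of [a] with a shift by [p]
    in between, which leaves as a shift by [q]. The sign [eps] lets the machine work with
    [(- p, - q)], which gives the same group. *)
Lemma BSker_run w : BSker p q w -> forall st, normal_state K st -> run (bs_act P K) w st = st.
Proof.
have aP := bs_action KP K0; apply: (nclos_run aP) => st nst.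
rewrite /bs_relator (run_wreduce aP) // !run_cat !run_bpow.
set st1 := (st.1 - q, st.2); have nst1 : normal_state K st1 by [].
rewrite /= /bs_act /=.
have := bs_stepK KP K0 false nst1; case: (bs_step P K false st1) => c l /= stE.
have -> : p = P true * eps by rewrite PE mulrAC eps2 mul1r.
rewrite (bs_step_shift KP) stE /= PE mulrAC eps2 mul1r subrK.
by rewrite -surjective_pairing.
Qed.

Let E := ncl_congr (bs_relator p q).
Let congE : word_congruence E := ncl_congr_congruence _.

Lemma congr_bpowD i j : E (bpow i ++ bpow j) (bpow (i + j)).
Proof.
have bS b k : E ((true, b) :: bpow k) (bpow ((if b then 1 else -1) + k)).
  case: b; case: k => n.
  - exact: (congr_refl congE).
  - have -> : 1 + Negz n = - n%:Z by lia.
    have -> : bpow (- n%:Z) = nseq n (true, false) by case: n => // n; rewrite -NegzE.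
    exact: (congr_flip congE (true, true)).
  - case: n => [|n]; first exact: (congr_refl congE).
    have -> : -1 + n.+1%:Z = n by lia.
    exact: (congr_flip congE (true, false)).
  - have -> : -1 + Negz n = Negz n.+1 by lia.
    exact: (congr_refl congE).
have nS b n k : E (nseq n (true, b) ++ bpow k) (bpow (n%:Z * (if b then 1 else -1) + k)).
  elim: n => [|n IHn] /=; first by rewrite mul0r add0r; apply: (congr_refl congE).
  apply: (congr_trans congE) (congr_cons congE _ IHn) _.
  have -> : n.+1%:Z * (if b then 1 else -1) + k
      = (if b then 1 else -1) + (n%:Z * (if b then 1 else -1) + k) by case: (b); lia.
  exact: bS.
have {2}-> : i = `|i|%N%:Z * (if 0 <= i then 1 else -1) by case: (lerP 0 i) => H; lia.
exact: nS.
Qed.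

Lemma congr_relation k : E (aw ++ bpow (P true * k)) (bpow (P false * k) ++ aw).
Proof.
have step : E (aw ++ bpow p) (bpow q ++ aw).
  have rel := congr_trans congE (congr_sym congE (congr_wreduce congE _))
    (ncl_congr_relator (bs_relator p q)).
  move: {rel}(congr_cat congE rel (congr_refl congE (bpow q ++ aw))).
  rewrite -!catA => rel; apply: (congr_trans congE) rel.
  apply: (congr_cat congE (congr_refl congE _)).
  rewrite -{1}[bpow p]cats0; apply: (congr_cat congE (congr_refl congE _)).
  rewrite [_ ++ bpow q ++ aw]catA.
  apply: (congr_sym congE).
  apply: (congr_trans congE (v := [:: (false, false)] ++ aw)).
    apply: (congr_cat congE (congr_refl congE _)).
    apply: (congr_cat congE (u' := [::]) (v' := aw)) (congr_refl congE _).
    by have := congr_bpowD (- q) q; rewrite addNr.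
  by apply: (congr_flip congE (false, false) [::]).
have nat_step n : E (aw ++ bpow (p * n%:Z)) (bpow (q * n%:Z) ++ aw).
  elim: n => [|n IHn]; first by rewrite !mulr0; apply: (congr_refl congE).
  have -> : p * n.+1%:Z = p * n%:Z + p by lia.
  have -> : q * n.+1%:Z = q * n%:Z + q by lia.
  apply: (congr_trans congE (v := bpow (q * n%:Z) ++ bpow q ++ aw)); last first.
    by rewrite catA; apply: (congr_cat congE (congr_bpowD _ _)); apply: (congr_refl congE).
  apply: (congr_trans congE (v := bpow (q * n%:Z) ++ aw ++ bpow p)); last first.
    exact: (congr_cat congE (congr_refl congE _)).
  apply: (congr_trans congE (v := aw ++ bpow (p * n%:Z) ++ bpow p)).
    apply: (congr_cat congE (congr_refl congE _)).
    exact/(congr_sym congE)/congr_bpowD.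
  by rewrite !catA; apply: (congr_cat congE IHn); apply: (congr_refl congE).
have int_step j : E (aw ++ bpow (p * j)) (bpow (q * j) ++ aw).
  case: j => n; first exact: nat_step.
  rewrite NegzE !mulrN.
  move: (nat_step n.+1); set x := p * _; set y := q * _ => xy.
  apply: (congr_trans congE (v := bpow (- y) ++ (bpow y ++ aw) ++ bpow (- x))).
    rewrite [in X in E _ X]catA catA.
    apply: (congr_cat congE) (congr_refl congE _).
    rewrite -[X in E X _]/([::] ++ aw).
    apply: (congr_cat congE) (congr_refl congE _).
    by apply: (congr_sym congE); have := congr_bpowD (- y) y; rewrite addNr.
  apply: (congr_cat congE (congr_refl congE _)).
  apply: (congr_trans congE (v := (aw ++ bpow x) ++ bpow (- x))).
    exact/(congr_cat congE)/(congr_refl congE)/(congr_sym congE).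
  rewrite -catA -[X in E _ X]cats0; apply: (congr_cat congE (congr_refl congE _)).
  by have := congr_bpowD x (- x); rewrite addrN.
have := int_step (eps * k).
by rewrite !PE !mulrA ![_ * eps]mulrC.
Qed.

Lemma congr_relationV k : E (Aw ++ bpow (P false * k)) (bpow (P true * k) ++ Aw).
Proof.
apply: (congr_sym congE).
apply: (congr_trans congE (v := Aw ++ (aw ++ bpow (P true * k)) ++ Aw)).
  by apply/(congr_sym congE); apply: (congr_flip congE (false, false)).
apply: (congr_cat congE (congr_refl congE _)).
apply: (congr_trans congE (v := (bpow (P false * k) ++ aw) ++ Aw)).
  exact: (congr_cat congE (congr_relation k) (congr_refl congE _)).
rewrite -catA -[X in E _ X]cats0; apply: (congr_cat congE (congr_refl congE _)).
exact: (congr_flip congE (false, true) [::]).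
Qed.

Definition stack_word (l : seq (bool * int)) : word :=
  flatten [seq (false, x.1) :: bpow x.2 | x <- l].

(** Each step of the machine is a consequence of the relator, so the final state, read back as a
    word, equals [w] in the group. A word with trivial normal form therefore lies in the kernel. *)
Lemma congr_run w : let st := run (bs_act P K) w (0, [::]) in
  E w (bpow st.1 ++ stack_word st.2).
Proof.
elim: w => [|x w IHw] /=; first exact: (congr_refl congE).
move: IHw => /=; set st := run _ _ _; case: st => c l /= IHw.
apply: (congr_trans congE (congr_cons congE x IHw)).
case: x => [[] e]; rewrite /bs_act /=.
  rewrite -cat_cons; apply: (congr_cat congE _ (congr_refl congE _)).
  have := congr_bpowD (if e then 1 else -1) c; rewrite addrC.
  by case: e.
have flipped k : E ((false, e) :: bpow (P e * k)) (bpow (P (~~ e) * k) ++ [:: (false, e)]).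
  by case: e; [apply: congr_relation|apply: congr_relationV].
have pushed : E ((false, e) :: bpow c ++ stack_word l)
   (bpow (P (~~ e) * K e c) ++ stack_word ((e, c - P e * K e c) :: l)).
  rewrite {1}(_ : c = P e * K e c + (c - P e * K e c)); last by rewrite addrC subrK.
  set k := K e c; set r := c - _.
  apply: (congr_trans congE (v := ((false, e) :: bpow (P e * k)) ++ bpow r ++ stack_word l)).
    rewrite cat_cons; apply: (congr_cons congE); rewrite catA.
    exact: (congr_cat congE (congr_sym congE (congr_bpowD _ _)) (congr_refl congE _)).
  apply: (congr_trans congE (congr_cat congE (flipped k) (congr_refl congE _))).
  by rewrite -catA; apply: (congr_refl congE).
rewrite /bs_step /=; case: l IHw pushed => [//|[e' t] l] _ pushed.
case: ifP => [/andP[/eqP r0 ee']|_] //=.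
apply: (congr_trans congE pushed); rewrite r0 /=.
apply: (congr_trans congE (v := bpow (P (~~ e) * K e c) ++ bpow t ++ stack_word l)).
  apply: (congr_cat congE (congr_refl congE _)).
  have -> : e' = ~~ e by case: (e) ee'; case: (e').
  exact: (congr_flip congE (false, e)).
rewrite catA; exact: (congr_cat congE (congr_bpowD _ _) (congr_refl congE _)).
Qed.

Lemma BSker_runE w :
  BSker p q (wreduce w) <-> run (bs_act P K) w (0, [::]) = (0, [::]).
Proof.
split=> [/BSker_run rw|w0].
  by rewrite -(run_wreduce (bs_action KP K0)) ?rw.
by apply/ncl_congr1; have := congr_run w; rewrite w0.
Qed.

End BaumslagSolitar.

(** * Digits and normal forms in the limit *)

(* [digit_s m x i] and [digit m x i] are the paper's [s_i(x)] and [r_(i+1)(x)]. *)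
Fixpoint digit_s (m x : int) (i : nat) : int :=
  if i is i'.+1 then ((x * digit_s m x i') %/ m)%Z else 1.

Definition digit (m x : int) (i : nat) : int := ((x * digit_s m x i) %% m)%Z.

Lemma digit_sE m x i : x * digit_s m x i = m * digit_s m x i.+1 + digit m x i.
Proof. by rewrite /= mulrC [m * _]mulrC /digit [x * _]mulrC -divz_eq. Qed.

(** Each division by [m] costs one level of precision, hence the [i] additional levels at the
    start. *)
Lemma digit_s_congr m x y k i : m != 0 ->
  (m ^+ (k + i) %| x - y)%Z -> (m ^+ k %| digit_s m x i - digit_s m y i)%Z.
Proof.
move=> m0; elim: i k => [|i IHi] k; first by rewrite subrr dvdz0.
rewrite addnS -addSn => xy.
have /dvdzP[u su] := IHi _ xy.
have /dvdzP[v xv] : (m ^+ k.+1 %| x - y)%Z.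
  by apply: dvdz_trans xy; rewrite exprD dvdz_mulr.
have -> : digit_s m x i.+1
    = ((y * digit_s m y i + m * (m ^+ k * (v * digit_s m x i + u * y))) %/ m)%Z.
  rewrite /=; congr (_ %/ _)%Z.
  transitivity (y * digit_s m y i + (x - y) * digit_s m x i
     + y * (digit_s m x i - digit_s m y i)); first by ring.
  by rewrite su xv exprS; ring.
by rewrite [y * _ + _]addrC [m * (_ * _)]mulrC divzMDl // addrK dvdz_mulr.
Qed.

Lemma digit_congr m x y i : m != 0 -> (m ^+ i.+1 %| x - y)%Z -> digit m x i = digit m y i.
Proof.
move=> m0 xy; apply/eqP; rewrite eqz_mod_dvd.
have -> : x * digit_s m x i - y * digit_s m y i
  = (x - y) * digit_s m x i + y * (digit_s m x i - digit_s m y i) by ring.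
apply: rpredD; first by apply/dvdz_mulr; apply: dvdz_trans xy; rewrite exprS dvdz_mulr.
by apply/dvdz_mull; rewrite -[m]expr1; apply: digit_s_congr; rewrite // add1n.
Qed.

Definition eventually (Q : nat -> Prop) : Prop :=
  exists N : nat, forall n : nat, (N <= n)%N -> Q n.

Lemma eventually_mono (Q R : nat -> Prop) : (forall n, Q n -> R n) -> eventually Q -> eventually R.
Proof. by move=> QR [N NQ]; exists N => n /NQ /QR. Qed.

Lemma eventually_and (Q R : nat -> Prop) :
  eventually Q -> eventually R -> eventually (fun n => Q n /\ R n).
Proof.
move=> [N NQ] [M MR]; exists (maxn N M) => n; rewrite geq_max => /andP[Nn Mn].
by split; [apply: NQ|apply: MR].
Qed.

Lemma eventually_and2 (Q R S : nat -> Prop) : (forall n, Q n -> R n -> S n) ->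
  eventually Q -> eventually R -> eventually S.
Proof.
move=> QRS eQ eR; apply: eventually_mono (eventually_and eQ eR) => n [].
exact: QRS.
Qed.

Lemma eventually_ltn (Q : nat -> nat -> Prop) k :
  (forall i, eventually (Q i)) -> eventually (fun n => forall i, (i < k)%N -> Q i n).
Proof.
move=> eQ; elim: k => [|k IHk]; first by exists 0%N.
apply: eventually_and2 IHk (eQ k) => n IH Qk i.
by rewrite ltnS leq_eqVlt => /orP[/eqP ->|/IH].
Qed.

Lemma eventually_ex (Q : nat -> Prop) : eventually Q -> exists n, Q n.
Proof. by case=> N NQ; exists N; apply: NQ. Qed.

(* [(c, t)] stands for [c e_0 + \sum_i t_i e_(i+1)] in the free abelian group E. *)
Definition edot (r : nat -> int) (t : seq int) : int := \sum_(i < size t) t`_i * r i.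

Definition lim_state := ((int * seq int) * seq (bool * int))%type.

(* [lim_rem] is the coset representative modulo the domain of [phi] (resp. of its
   inverse), and [lim_quo] the image of the rest under [phi] (resp. its inverse). *)
Definition lim_rem (m : int) (r : nat -> int) (e : bool) (f : int * seq int) : int :=
  if e then ((f.1 + edot r f.2) %% m)%Z else f.1.

Definition lim_quo (m : int) (r : nat -> int) (e : bool) (f : int * seq int) : int * seq int :=
  if e then (0, ((f.1 + edot r f.2) %/ m)%Z :: f.2)
  else if f.2 is t0 :: t then (m * t0 - edot r t, t) else (0, [::]).

Definition lim_step m r (e : bool) (st : lim_state) : lim_state :=
  let f := lim_quo m r e st.1 in
  let z := lim_rem m r e st.1 in
  match st.2 with
  | (e', t) :: l => if (z == 0) && (e' != e) then ((f.1 + t, f.2), l)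
                    else (f, (e, z) :: st.2)
  | [::] => (f, (e, z) :: st.2)
  end.

Definition lim_act m r (x : letter) (st : lim_state) : lim_state :=
  if x.1 then ((st.1.1 + (if x.2 then 1 else -1), st.1.2), st.2) else lim_step m r x.2 st.

Definition lim_run m r (w : word) : lim_state := run (lim_act m r) w ((0, [::]), [::]).

Definition lim_kernel m r (w : word) : Prop :=
  [/\ (lim_run m r w).2 = [::], (lim_run m r w).1.1 = 0
    & all (fun x => x == 0) (lim_run m r w).1.2].

Definition bsP (m s : int) (e : bool) : int := if e then m else s.

(* Remainders modulo [s] are centered at 0, so that a fixed integer is its own
   remainder as soon as [s] is large. *)
Definition bsK (m s : int) (e : bool) (c : int) : int :=
  if e then (c %/ m)%Z else ((c + (`|s|%N %/ 2)%N%:Z) %/ s)%Z.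

Lemma bsKP (m s : int) : m != 0 -> s != 0 ->
  forall e (c : int), bsK m s e (c + bsP m s e) = bsK m s e c + 1.
Proof.
move=> m0 s0 [] c; rewrite /bsK /bsP /=; first by rewrite divzDr // divzz m0.
by rewrite addrAC [LHS]divzDr // divzz s0.
Qed.

Lemma bsK_small (m s c : int) : s != 0 -> (`|c| * 2 < `|s|)%N -> bsK m s false c = 0.
Proof.
move=> s0 cs; rewrite /bsK; apply/eqP; apply/eqP.
apply: divz_small; have := leq_div `|s|%N 2; lia.
Qed.

Lemma bsK0 (m s : int) : s != 0 -> forall e, bsK m s e 0 = 0.
Proof. by move=> s0 []; [rewrite /bsK div0z|rewrite bsK_small //; lia]. Qed.

(** This is the evaluation of polynomials at [X = s / m], where [a b^m a^-1 = b^s] in BS(m, s): it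
    sends [e_0] to 1 and, when the [r_i] are the digits of [s], [e_(i+1)] to [s * digit_s m s i]. *)
Definition lattice_eval (m s : int) (f : int * seq int) : int :=
  f.1 + s * \sum_(i < size f.2) (f.2)`_i * digit_s m s i.

(** Evaluation turns one step of the formal algorithm into one step in BS(m, s). Agreement of digits
    serves the letter [a], and smallness of the [e_0] coefficient the letter [a^-1], where it has to
    be its own centered remainder. *)
Lemma lattice_eval_quo m s r e f : m != 0 -> s != 0 ->
  (forall i, (i < size f.2)%N -> digit m s i = r i) -> (`|f.1| * 2 < `|s|)%N ->
  bsP m s (~~ e) * bsK m s e (lattice_eval m s f) = lattice_eval m s (lim_quo m r e f)
  /\ lattice_eval m s f - bsP m s e * bsK m s e (lattice_eval m s f) = lim_rem m r e f.
Proof.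
case: f => c t /= m0 s0 rE cs.
have dotE u : (size u <= size t)%N ->
    m * (\sum_(i < size u) u`_i * digit_s m s i.+1) + edot r u
    = s * \sum_(i < size u) u`_i * digit_s m s i.
  move=> ut; rewrite /edot !mulr_sumr -big_split; apply: eq_bigr => i _ /=.
  by rewrite -rE ?(leq_trans (ltn_ord i)) // mulrCA -mulrDr -digit_sE mulrCA.
have sumS t0 u : \sum_(i < size (t0 :: u)) (t0 :: u)`_i * digit_s m s i
    = t0 + \sum_(i < size u) u`_i * digit_s m s i.+1.
  by rewrite big_ord_recl /= mulr1.
case: e; rewrite /bsP /lim_quo /lim_rem.
  have evE : lattice_eval m s (c, t)
      = (\sum_(i < size t) t`_i * digit_s m s i.+1) * m + (c + edot r t).
    by rewrite /lattice_eval -dotE //; ring.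
  rewrite /bsK evE divzMDl //; split.
    by rewrite /lattice_eval sumS /= add0r addrC.
  rewrite {1}(divz_eq (c + edot r t) m); ring.
have KE : bsK m s false (lattice_eval m s (c, t)) = \sum_(i < size t) t`_i * digit_s m s i.
  have KMs j : bsK m s false (s * j + c) = j + bsK m s false c := KMD (bsKP m0 s0) false j c.
  by rewrite /lattice_eval addrC KMs bsK_small // addr0.
rewrite KE; split; last by rewrite /lattice_eval /= addrK.
case: t {KE sumS} dotE (sumS) rE => [|t0 t] dotE sumS rE /=.
  by rewrite /lattice_eval /= !big_ord0 !mulr0 addr0.
rewrite sumS /lattice_eval /= -dotE //; ring.
Qed.

Section Simulation.
Variables (m : int) (r : nat -> int) (s : nat -> int).
Hypothesis m0 : m != 0.
Hypothesis s_inf : tends_infty s.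
Hypothesis s_digit : forall i, eventually (fun n => digit m (s n) i = r i).

Lemma eventually_neq0 : eventually (fun n => s n != 0).
Proof. by apply: eventually_mono (s_inf 1%N) => n; case: (s n =P 0) => // ->. Qed.

Definition state_eval (n : nat) (st : lim_state) : bs_state := (lattice_eval m (s n) st.1, st.2).

Notation act n := (bs_act (bsP m (s n)) (bsK m (s n))).

(** Each letter adds its own threshold: [s n] must dominate the current coefficient of [e_0] and
    have the prescribed digits for all coordinates of the current state. *)
Lemma eventually_lim_run w :
  eventually (fun n => run (act n) w (0, [::]) = state_eval n (lim_run m r w)).
Proof.
elim: w => [|x w IHw].
  by exists 0%N => n _; rewrite /state_eval /lattice_eval /= big_ord0 mulr0.
rewrite /lim_run /= -/(lim_run m r w).
case: (lim_run m r w) IHw => [[c t] l] IHw.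
have big := s_inf (`|c| * 2).+1.
have dig := eventually_ltn (size t) s_digit.
apply: eventually_and2 (eventually_and eventually_neq0 IHw) (eventually_and big dig).
move=> n [sn0 ->] [cs rE].
case: x => [[] e].
  by rewrite /bs_act /lim_act /state_eval /lattice_eval /= addrAC.
rewrite /bs_act /lim_act /= /bs_step /lim_step /state_eval /=.
have [-> ->] := @lattice_eval_quo m (s n) r e (c, t) m0 sn0 rE cs.
case: l {IHw} => [//|[e' z] l]; case: ifP => // _.
by rewrite /lattice_eval /= addrAC.
Qed.

(** The coefficient of [e_0] is divisible by arbitrarily large [s n], so it is zero. The point is
    then [X] times a point with one coordinate fewer, which also vanishes eventually. *)
Lemma lattice_eval_eq0 f : eventually (fun n => lattice_eval m (s n) f = 0) ->
  f.1 = 0 /\ all (fun x => x == 0) f.2.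
Proof.
case: f => c t /=; elim: t c => [|t0 t IHt] c f0.
  by have [n] := eventually_ex f0; rewrite /lattice_eval /= big_ord0 mulr0 addr0.
have c0 : c = 0.
  have [n [cs]] := eventually_ex (eventually_and (s_inf `|c|.+1) f0).
  move=> /eqP; rewrite /lattice_eval /= addr_eq0 => /eqP cE.
  have : (`|s n| %| `|c|)%N by rewrite cE abszN abszM dvdn_mulr.
  by case: (posnP `|c|%N) => [/eqP|cp /(dvdn_leq cp)]; rewrite ?absz_eq0; [move/eqP|lia].
(* Division by [X] sends [e_1] to [m e_0] and [e_(i+2)] to [e_(i+1) - r_i e_0], which gives this
   coefficient of [e_0]. *)
have [|e0 t0s] := IHt (m * t0 - edot r t).
  have dig := eventually_ltn (size t) s_digit.
  apply: eventually_and2 (eventually_and f0 eventually_neq0) dig => n [e0 sn0] rE.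
  have e1 : t0 + \sum_(i < size t) t`_i * digit_s m (s n) i.+1 = 0.
    move/eqP: e0; rewrite /lattice_eval c0 add0r mulf_eq0 (negPf sn0) /=.
    by rewrite big_ord_recl /= mulr1 => /eqP.
  transitivity (m * (t0 + \sum_(i < size t) t`_i * digit_s m (s n) i.+1)); last by rewrite e1 mulr0.
  rewrite /lattice_eval mulrDr -addrA; congr (_ + _).
  apply/eqP; rewrite addrC subr_eq /edot !mulr_sumr -big_split; apply/eqP.
  by apply: eq_bigr => i _; rewrite -rE // mulrCA digit_sE mulrDr mulrCA.
split=> //=; rewrite t0s andbT.
move: e0; rewrite /edot big1 ?subr0 => [/eqP|i _].
  by rewrite mulf_eq0 (negPf m0).
by have /allP/(_ _ (mem_nth 0 (ltn_ord i)))/eqP -> := t0s; rewrite mul0r.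
Qed.

Lemma lim_kernelP w :
  lim_kernel m r w <-> eventually (fun n => run (act n) w (0, [::]) = (0, [::])).
Proof.
rewrite /lim_kernel; have := eventually_lim_run w; case: (lim_run m r w) => [[c t] l] /= wE.
split=> [[l0 c0 t0]|w0].
  move: wE; rewrite l0 c0 => wE; apply: eventually_mono wE => n ->.
  rewrite /state_eval /lattice_eval /= add0r.
  rewrite big1 ?mulr0 // => i _.
  by have /allP/(_ _ (mem_nth 0 (ltn_ord i)))/eqP -> := t0; rewrite mul0r.
have e0 : eventually (fun n => state_eval n (c, t, l) = (0, [::])).
  by apply: eventually_and2 wE w0 => n <-.
have [//|c0 t0] := @lattice_eval_eq0 (c, t).
  by apply: eventually_mono e0 => n [].
by have [n []] := eventually_ex e0.
Qed.

End Simulation.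

(** * Representations of the limit group *)

Section Model.
Variables (m : int) (r : nat -> int).
Variables (T : Type) (eqT : T -> T -> Prop) (act : letter -> T -> T).
Variable tau : int * seq int -> T -> T.

(** Here [tau f] is the action of the lattice element [f]. The axioms are the rewritings used by the
    formal algorithm; they hold up to [eqT] because the Heisenberg action below satisfies them only
    modulo integers. *)
Record limit_model : Prop := LimitModel {
  model_refl : forall x, eqT x x;
  model_sym : forall x y, eqT x y -> eqT y x;
  model_trans : forall x y z, eqT x y -> eqT y z -> eqT x z;
  model_act : forall l x y, eqT x y -> eqT (act l x) (act l y);
  model_tau : forall f x y, eqT x y -> eqT (tau f x) (tau f y);
  model_actK : forall l x, act (lflip l) (act l x) = x;
  model_tau0 : forall f x, f.1 = 0 -> all (fun z => z == 0) f.2 -> eqT (tau f x) x;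
  model_b : forall (e : bool) f x,
    eqT (act (true, e) (tau f x)) (tau (f.1 + (if e then 1 else -1), f.2) x);
  model_split : forall (c z : int) t x, eqT (tau (c + z, t) x) (tau (c, t) (tau (z, [::]) x));
  model_a : forall (k : int) t x,
    eqT (act (false, true) (tau (m * k - edot r t, t) x)) (tau (0, k :: t) (act (false, true) x));
  model_aV : forall (k : int) t x,
    eqT (act (false, false) (tau (0, k :: t) x)) (tau (m * k - edot r t, t) (act (false, false) x))
}.

Hypothesis modelP : limit_model.

Definition stack_act (l : seq (bool * int)) (x : T) : T :=
  foldr (fun y z => act (false, y.1) (tau (y.2, [::]) z)) x l.

Lemma model_pushes e f x :
  eqT (act (false, e) (tau f x))
      (tau (lim_quo m r e f) (act (false, e) (tau (lim_rem m r e f, [::]) x))).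
Proof.
case: f => c t; case: e; rewrite /lim_quo /lim_rem /=.
  set k := (_ %/ _)%Z; set z := (_ %% _)%Z.
  have {1}-> : c = (m * k - edot r t) + z.
    by apply: (addIr (edot r t)); rewrite {1}(divz_eq (c + edot r t) m) /k /z; ring.
  apply: (model_trans modelP) (model_act modelP _ (model_split modelP _ _ _ _)) _.
  exact: model_a.
have {1}-> : c = 0 + c by rewrite add0r.
apply: (model_trans modelP) (model_act modelP _ (model_split modelP _ _ _ _)) _.
case: t => [|t0 t]; last exact: model_aV.
apply: (model_trans modelP) (model_act modelP _ (model_tau0 modelP _ _ _)) _ => //.
exact/(model_sym modelP)/(model_tau0 modelP).
Qed.

(** The formal algorithm uses only rules that are valid in every model, so its final state acts as
    [w] does. For a kernel word that state is trivial. *)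
Lemma model_run w x :
  eqT (run act w x) (tau (lim_run m r w).1 (stack_act (lim_run m r w).2 x)).
Proof.
elim: w => [|[[] e] w IHw]; first exact/(model_sym modelP)/(model_tau0 modelP).
  rewrite /lim_run /=; apply: (model_trans modelP) (model_act modelP _ IHw) _.
  exact: model_b.
rewrite /lim_run /= -/(lim_run m r w); apply: (model_trans modelP) (model_act modelP _ IHw) _.
case: (lim_run m r w) => f l {IHw}; rewrite /lim_act /= /lim_step /=.
have push := model_pushes e f (stack_act l x).
case: l push => [//|[e' t] l] push; case: ifP => [/andP[/eqP z0 ee']|_]; last exact: push.
apply: (model_trans modelP) push _; rewrite z0.
set y := tau (t, [::]) (stack_act l x).
apply: (model_trans modelP (y := tau (lim_quo m r e f) y)).
  apply: (model_tau modelP); apply: (model_trans modelP (y := act (false, e) (act (false, e') y))).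
    exact/(model_act modelP)/(model_tau0 modelP).
  have -> : (false, e) = lflip (false, e') by case: (e) ee'; case: (e').
  by rewrite (model_actK modelP); apply: (model_refl modelP).
apply/(model_sym modelP); case: (lim_quo m r e f) => c u; exact: (model_split modelP).
Qed.

Lemma lim_kernel_model w x : lim_kernel m r w -> eqT (run act w x) x.
Proof.
move=> [l0 c0 t0]; apply: (model_trans modelP) (model_run w x) _.
by rewrite l0; apply: (model_tau0 modelP).
Qed.

End Model.

Section BasisValues.
Variables (m : int) (r : nat -> int) (V : zmodType).
Implicit Types theta : int -> V.

(* The value on [e_(j+1)] of the functional on E that sends [e_0 = X^0] to [theta k],
   when E is identified with the lattice of integral polynomials generated by
   [e_0 = 1], [e_1 = m X], [e_(i+1) = X (e_i - r_i)] and X^i is sent to [theta (k + i)]. *)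
Fixpoint basis_value theta (j : nat) (k : int) : V :=
  if j is j'.+1 then basis_value theta j' (k + 1) - theta (k + 1) *~ r j'
  else theta (k + 1) *~ m.

Definition lattice_value theta (k : int) (f : int * seq int) : V :=
  theta k *~ f.1 + \sum_(i < size f.2) basis_value theta i k *~ f.2`_i.

(** This is the explicit form [e_(j+1) = m X^(j+1) - \sum_(i < j) r_i X^(j-i)] of the basis. *)
Lemma basis_valueE theta j k : basis_value theta j k =
  theta (k + j%:Z + 1) *~ m - \sum_(i < j) theta (k + j%:Z - i%:Z) *~ r i.
Proof.
elim: j k => [|j IHj] k /=; first by rewrite big_ord0 subr0 addr0.
rewrite IHj big_ord_recr /= opprD addrA.
have -> : k + 1 + j%:Z + 1 = k + j.+1%:Z + 1 by lia.
have -> : k + j.+1%:Z - j%:Z = k + 1 by lia.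
congr (_ - _ - _); apply: eq_bigr => i _; congr (theta _ *~ _); lia.
Qed.

(** The lattice element on the left is [X] times the one on the right, and a factor [X] shifts the
    base exponent by one. *)
Lemma lattice_value_cons theta k (c : int) t :
  lattice_value theta (k - 1) (0, c :: t) = lattice_value theta k (m * c - edot r t, t).
Proof.
rewrite /lattice_value /= mulr0z add0r big_ord_recl /= subrK mulrzBr mulrzA -addrA; congr (_ + _).
rewrite /edot (raddf_sum (intmul (theta k))) addrC -sumrB /=.
by apply: eq_bigr => i _; rewrite mulrzBl -!mulrzA [r i * _]mulrC.
Qed.

Lemma lattice_value_addl theta k c z t :
  lattice_value theta k (c + z, t) = lattice_value theta k (c, t) + theta k *~ z.
Proof. by rewrite /lattice_value /= mulrzDr addrAC. Qed.

Lemma lattice_value1 theta k z : lattice_value theta k (z, [::]) = theta k *~ z.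
Proof. by rewrite /lattice_value /= big_ord0 addr0. Qed.

Lemma lattice_value0 theta k f :
  f.1 = 0 -> all (fun z => z == 0) f.2 -> lattice_value theta k f = 0.
Proof.
move=> f0 t0; rewrite /lattice_value f0 mulr0z add0r big1 // => i _.
by have /allP/(_ _ (mem_nth 0 (ltn_ord i)))/eqP -> := t0; rewrite mulr0z.
Qed.

End BasisValues.

Definition lsign (x : letter) : int := if x.2 then 1 else -1.

Fixpoint asum (w : word) : int :=
  if w is x :: w' then (if x.1 then 0 else lsign x) + asum w' else 0.

(* [heights w] lists the pairs [(e, n)] such that, in the free group, [w] is the product of
   the [a^n b^e a^-n], in order, times [a^(asum w)]. *)
Fixpoint heights (w : word) : seq (int * int) :=
  if w is x :: w' then
    if x.1 then (lsign x, 0) :: heights w' else [seq (y.1, lsign x + y.2) | y <- heights w']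
  else [::].

(** The list codes a Laurent polynomial; this is its image under the additive map that sends [X^n]
    to [theta n]. *)
Definition hsum (V : zmodType) (theta : int -> V) (l : seq (int * int)) : V :=
  \sum_(x <- l) theta x.2 *~ x.1.

Lemma eq_hsum (V : zmodType) (t1 t2 : int -> V) l : t1 =1 t2 -> hsum t1 l = hsum t2 l.
Proof. by move=> e; apply: eq_bigr => x _; rewrite e. Qed.

Lemma hsum_cat (V : zmodType) (theta : int -> V) l1 l2 :
  hsum theta (l1 ++ l2) = hsum theta l1 + hsum theta l2.
Proof. exact: big_cat. Qed.

Lemma hsum_cons (V : zmodType) (theta : int -> V) x l :
  hsum theta (x :: l) = theta x.2 *~ x.1 + hsum theta l.
Proof. exact: big_cons. Qed.

Lemma hsum_shift (V : zmodType) (theta : int -> V) (j : int) l :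
  hsum theta [seq (y.1, j + y.2) | y <- l] = hsum (fun n => theta (j + n)) l.
Proof. by rewrite /hsum big_map. Qed.

(** * The affine representation, through [Z wr Z] *)

Section Affine.
Variables (K : fieldType) (X : K).
Hypothesis X0 : X != 0.

Definition affine_act (l : letter) (y : K) : K :=
  if l.1 then y + (lsign l)%:~R else X ^ lsign l * y.

Lemma affine_actK l y : affine_act (lflip l) (affine_act l y) = y.
Proof.
case: l => [[] []]; rewrite /affine_act /lsign /= ?addrK ?subrK //.
  by rewrite -exprnN expr1 mulKf.
by rewrite -exprnN expr1 mulVKf.
Qed.

Lemma affine_action : letter_action (fun _ => True) affine_act.
Proof. by split=> // l y _; apply: affine_actK. Qed.

Lemma run_affine w y :
  run affine_act w y = X ^ asum w * y + hsum (fun n => X ^ n) (heights w).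
Proof.
elim: w => [|l w IHw] /=; first by rewrite /hsum big_nil addr0 mul1r.
rewrite IHw /affine_act; case: l => [[] e] /=.
  by rewrite add0r hsum_cons /= expr0z [in RHS]addrCA addrC.
rewrite mulrDr mulrA -expfzDr // hsum_shift /hsum mulr_sumr; congr (_ + _).
by apply: eq_bigr => x _; rewrite expfzDr // mulrzAr.
Qed.

Variables (m : int) (r : nat -> int).

Lemma lattice_value_exp k f :
  X * lattice_value m r (fun k => X ^ k) k f = lattice_value m r (fun k => X ^ k) (k + 1) f.
Proof.
have expS j : X * X ^ j = X ^ (j + 1) by rewrite expfzDr // expr1z mulrC.
rewrite /lattice_value mulrDr mulrzAr expS mulr_sumr; congr (_ + _).
apply: eq_bigr => i _; rewrite mulrzAr; congr (_ *~ _).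
elim: (nat_of_ord i) k => [|j IHj] k /=; first by rewrite mulrzAr expS.
by rewrite mulrBr IHj mulrzAr expS.
Qed.

(** Lattice elements act by translations, by their values as polynomials in [X]; conjugation by [a]
    multiplies these by [X]. *)
Lemma affine_model : limit_model m r eq affine_act
  (fun f y => y + lattice_value m r (fun k => X ^ k) 0 f).
Proof.
split=> //.
- by move=> x y z ->.
- by move=> l x y ->.
- by move=> f x y ->.
- exact: affine_actK.
- by move=> f x f0 t0; rewrite lattice_value0 ?addr0.
- by move=> e [c t] x; rewrite lattice_value_addl /affine_act /= expr0z -addrA.
- move=> c z t x; rewrite lattice_value1 lattice_value_addl.
  by rewrite -[RHS]addrA; congr (_ + _); exact: addrC.
- move=> k t x; rewrite /affine_act /= mulrDr; congr (_ + _).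
  by rewrite -lattice_value_cons lattice_value_exp add0r addNr.
- move=> k t x; rewrite /affine_act /= mulrDr; congr (_ + _).
  apply: (mulfI X0); rewrite mulrA -{1}[X]expr1z -expfzDr // addrN expr0z mul1r.
  by rewrite -lattice_value_cons lattice_value_exp add0r addNr.
Qed.

End Affine.

(* [a] translates the fibre coordinate [k], and on the k-th fibre [b] acts on the pairs
   [(v, z)] as an element of the Heisenberg group; [z] only matters modulo 1. *)
Section Heisenberg.
Variables (lam mu : int -> rat).

Definition heis_act (l : letter) (s : int * (rat * rat)) : int * (rat * rat) :=
  let: (k, (v, z)) := s in
  if l.1 then (k, (v + lam k *~ lsign l, z + (mu k * v) *~ lsign l))
  else (k - lsign l, (v, z)).

Definition heis_eq (s s' : int * (rat * rat)) : Prop :=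
  [/\ s.1 = s'.1, s.2.1 = s'.2.1 & s.2.2 - s'.2.2 \is a Num.int].

Lemma run_heis w k : exists C, forall v z,
  run heis_act w (k, (v, z)) =
  (k - asum w, (v + hsum (fun n => lam (k - asum w + n)) (heights w),
                z + hsum (fun n => mu (k - asum w + n)) (heights w) * v + C)).
Proof.
elim: w => [|l w [C IHw]].
  by exists 0 => v z; rewrite /hsum /= !big_nil subr0 mul0r !addr0.
case: l => [[] e] /=.
  exists (C + (mu (k - asum w) * hsum (fun n => lam (k - asum w + n)) (heights w))
    *~ lsign (true, e)).
  move=> v z; rewrite IHw /heis_act /= !add0r !hsum_cons /= !addr0.
  congr (_, (_, _)); first by ring.
  rewrite mulrDr mulrDl mulrzDl !mulrzAl; ring.
exists C => v z; rewrite IHw /heis_act /= !hsum_shift.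
have kE : k - asum w - lsign (false, e) = k - (lsign (false, e) + asum w) by ring.
rewrite kE; congr (_, (_ + _, _ + _ * _ + _)); apply: eq_hsum => n; congr (_ _); ring.
Qed.

Variables (m : int) (r : nat -> int).
Hypothesis lam_mu : forall k, lam k * mu k = 0.
Hypothesis lattice_int : forall k f g,
  lattice_value m r mu k f * lattice_value m r lam k g \is a Num.int.

Lemma heis_actK l s : heis_act (lflip l) (heis_act l s) = s.
Proof.
case: s => k [v z]; case: l => [[] e]; rewrite /heis_act /=; last first.
  by congr (_, _); case: e; rewrite /lsign /= ?subrK ?opprK ?addrK ?subrK.
have e0 : mu k * lam k = 0 by rewrite mulrC lam_mu.
have -> : lsign (lflip (true, e)) = - lsign (true, e) by case: e.
rewrite /= mulrDr mulrzAr e0 mul0rz addr0 !mulrNz !addrK //.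
Qed.

(** Moving [b] or a multiple of [e_0] past a lattice element changes [z] by a product of a [mu]
    value and a [lam] value, which is an integer by [lattice_int]. *)
Lemma heis_model : limit_model m r heis_eq heis_act
  (fun f s => (s.1, (s.2.1 + lattice_value m r lam s.1 f,
                     s.2.2 + lattice_value m r mu s.1 f * s.2.1))).
Proof.
have mu1 k : mu k = lattice_value m r mu k (1, [::]) by rewrite lattice_value1.
have lamz k z : lam k *~ z = lattice_value m r lam k (z, [::]) by rewrite lattice_value1.
split.
- by move=> x; split=> //; rewrite subrr.
- by move=> x y [e1 e2 e3]; split=> //; rewrite -opprB rpredN.
- move=> x y z [e1 e2 e3] [e4 e5 e6]; split; rewrite ?e1 ?e2 //.
  by rewrite -(subrK y.2.2 x.2.2) -addrA rpredD.
- move=> l [k [v z]] [k' [v' z']] [/= <- <- zz].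
  case: l => [[] e]; split=> //=.
  by rewrite opprD addrACA subrr addr0.
- move=> f [k [v z]] [k' [v' z']] [/= <- <- zz]; split=> //=.
  by rewrite opprD addrACA subrr addr0.
- exact: heis_actK.
- move=> f [k [v z]] f0 t0; rewrite !lattice_value0 // mul0r !addr0 /=.
  by split=> //=; rewrite subrr.
- move=> e [c t] [k [v z]]; split=> //=; first by rewrite lattice_value_addl -[LHS]addrA.
  rewrite lattice_value_addl.
  set L := lattice_value _ _ lam _ _; set M := lattice_value _ _ mu _ _.
  have -> : z + M * v + (mu k * (v + L)) *~ lsign (true, e)
      - (z + (M + mu k *~ (if e then 1 else -1)) * v) = (mu k * L) *~ lsign (true, e).
    by case: e; rewrite /lsign /=; ring.
  by rewrite mu1; apply: rpredMz; exact: lattice_int.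
- move=> c z t [k [v x]]; split=> //=.
    rewrite lattice_value_addl lattice_value1.
    by rewrite -[RHS]addrA; congr (_ + _); exact: addrC.
  rewrite lattice_value_addl !lattice_value1 lamz.
  have := lattice_int k (c, t) (z, [::]).
  set L := lattice_value _ _ lam _ _; set M := lattice_value _ _ mu _ _ => ML.
  have -> : x + (M + mu k *~ z) * v - (x + mu k *~ z * v + M * (v + L)) = - (M * L) by ring.
  by rewrite rpredN.
- move=> k t [j [v x]]; rewrite -2!lattice_value_cons; split=> //=; last by rewrite subrr.
- move=> k t [j [v x]]; rewrite -2!lattice_value_cons /=.
  by rewrite opprK addrK; split=> //=; rewrite subrr.
Qed.

End Heisenberg.

(** * Integral Laurent polynomials in a transcendental element *)

(** Evaluation at 0 shows that [X] divides one of the factors; once all powers of [X] are removed, a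
    unit of [Z[X]] remains, that is, a sign. *)
Lemma mul_eq_polyXn (p q : {poly int}) n : p * q = 'X^n ->
  exists eps k, (eps = 1 \/ eps = -1) /\ p = eps *: 'X^k.
Proof.
elim: n p q => [|n IHn] p q pq.
  have : p \is a GRing.unit by apply/unitrP; exists q; rewrite mulrC pq expr0.
  rewrite poly_unitE => /andP[/eqP p1 /orP u].
  exists p`_0, 0%N; split; first by case: u => /eqP; auto.
  by rewrite expr0 alg_polyC; apply: size1_polyC; rewrite p1.
have : (p * q).[0] = 0 by rewrite pq hornerXn expr0n.
move=> /eqP; rewrite hornerM mulf_eq0 => /orP[|] /factor_theorem[s sE];
  rewrite subr0 in sE.
  have [|eps [k [e sX]]] := IHn s q.
    apply: (mulIf (monic_neq0 (monicX _))); by rewrite -exprSr -pq sE mulrAC.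
  by exists eps, k.+1; split=> //; rewrite sE sX exprSr scalerAl.
apply: (IHn p s); apply: (mulIf (monic_neq0 (monicX _))); by rewrite -exprSr -pq sE mulrA.
Qed.

Section Laurent.
Variables (K : fieldType) (X : K).
Hypothesis X_free : forall p : {poly int}, (map_poly intr p).[X] = 0 -> p = 0.

Lemma transcendental_neq0 : X != 0.
Proof.
apply/eqP => X0; have /eqP : ('X : {poly int}) = 0.
  by apply: X_free; rewrite map_polyX hornerX X0.
by rewrite (negPf (monic_neq0 (monicX _))).
Qed.
Let X0 := transcendental_neq0.

Definition shift_poly (B : nat) (l : seq (int * int)) : {poly int} :=
  \sum_(x <- l) x.1 *: 'X^(absz (x.2 + B%:Z)%R).

Lemma shift_bound (l : seq (int * int)) : exists B : nat, forall x, x \in l -> 0 <= x.2 + B%:Z.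
Proof.
elim: l => [|y l [B HB]]; first by exists 0%N.
have aux (a : int) (b c : nat) : 0 <= a + b%:Z -> 0 <= a + (b + c)%N%:Z by lia.
have aux' (a : int) (b : nat) : 0 <= a + (b + `|a|)%N%:Z by lia.
by exists (B + `|y.2|)%N => x; rewrite inE => /orP[/eqP ->|/HB /aux].
Qed.

Lemma horner_shift_poly (B : nat) l : (forall x, x \in l -> 0 <= x.2 + B%:Z) ->
  (map_poly intr (shift_poly B l)).[X] = X ^ B * hsum (fun n => X ^ n) l.
Proof.
move=> HB; rewrite /shift_poly rmorph_sum horner_sum /hsum mulr_sumr.
apply: eq_big_seq => x xl; have xB := HB x xl.
rewrite /= map_polyZ map_polyXn hornerZ hornerXn mulrzAr -expfzDr //.
rewrite -mulrzl; congr (_ * _).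
by rewrite -[X ^+ _]/(X ^ `|_|%N%:Z) gez0_abs // addrC.
Qed.

(** As [X] is transcendental, all coefficients vanish once denominators are cleared, and
    [hsum theta] depends on the coefficients alone. *)
Lemma laurent_eq0 l (V : zmodType) (theta : int -> V) :
  hsum (fun n => X ^ n) l = 0 -> hsum theta l = 0.
Proof.
have [B HB] := shift_bound l => l0.
have /X_free p0 : (map_poly intr (shift_poly B l)).[X] = 0.
  by rewrite horner_shift_poly // l0 mulr0.
(* The sum of the shifted exponents is a crude bound for each of them. *)
pose D := (\sum_(x <- l) absz (x.2 + B%:Z)%R)%N.+1.
have xD x : x \in l -> (absz (x.2 + B%:Z)%R < D)%N.
  by move=> xl; rewrite /D (big_rem x xl) /= ltnS leq_addr.
transitivity (\sum_(i < D) theta (i%:Z - B%:Z) *~ (shift_poly B l)`_i); last first.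
  by rewrite p0 big1 // => i _; rewrite coef0 mulr0z.
transitivity (\sum_(i < D) \sum_(x <- l)
    theta (i%:Z - B%:Z) *~ (x.1 * (i == absz (x.2 + B%:Z)%R :> nat)%:R)).
  rewrite exchange_big /=; apply: eq_big_seq => x xl.
  rewrite (bigD1 (Ordinal (xD x xl))) //= eqxx mulr1 big1 => [|i]; last first.
    by rewrite -val_eqE /= => /negPf ->; rewrite mulr0 mulr0z.
  by rewrite addr0 gez0_abs ?HB // addrK.
apply: eq_bigr => i _; rewrite /shift_poly coef_sum raddf_sum; apply: eq_bigr => x _.
by rewrite /= coefZ coefXn.
Qed.

Lemma laurent_eq l l' (V : zmodType) (theta : int -> V) :
  hsum (fun n => X ^ n) l = hsum (fun n => X ^ n) l' -> hsum theta l = hsum theta l'.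
Proof.
have hsumN (W : zmodType) (t : int -> W) : hsum t [seq (- x.1, x.2) | x <- l'] = - hsum t l'.
  by rewrite /hsum big_map -sumrN; apply: eq_bigr => x _; rewrite mulrNz.
move=> ll; apply/eqP; rewrite -subr_eq0 -hsumN -hsum_cat; apply/eqP/laurent_eq0.
by rewrite hsum_cat hsumN ll subrr.
Qed.

Lemma laurent_exp_eq1 (k : int) : X ^ k = 1 -> k = 0.
Proof.
move=> Xk; have := @laurent_eq [:: (1, k)] [:: (1, 0)] int (fun n => (n == k)%:R).
rewrite /hsum !big_seq1 /= eqxx expr0z Xk => /(_ erefl).
by case: eqP => [<-|].
Qed.

(** Clearing denominators turns the inverse pair into a factorization of a power of [X]. *)
Lemma laurent_unit l l' : hsum (fun n => X ^ n) l * hsum (fun n => X ^ n) l' = 1 ->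
  exists eps k, (eps = 1 \/ eps = -1) /\ hsum (fun n => X ^ n) l = eps%:~R * X ^ k.
Proof.
have [B HB] := shift_bound l; have [B' HB'] := shift_bound l' => ll.
have /mul_eq_polyXn[eps [k [e pE]]] : shift_poly B l * shift_poly B' l' = 'X^(B + B').
  apply/eqP; rewrite -subr_eq0; apply/eqP/X_free.
  rewrite rmorphB rmorphM /= map_polyXn hornerD hornerN hornerM hornerXn.
  rewrite !horner_shift_poly // mulrACA ll mulr1 -[X ^+ _]/(X ^ (B + B')%N%:Z).
  by rewrite PoszD expfzDr // subrr.
exists eps, (k%:Z - B%:Z); split=> //.
apply: (mulfI (expfz_neq0 B X0)); rewrite -horner_shift_poly // pE.
rewrite map_polyZ map_polyXn hornerZ hornerXn mulrCA -expfzDr //.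
by rewrite addrC subrK.
Qed.

End Laurent.

Lemma asum_cat u v : asum (u ++ v) = asum u + asum v.
Proof. by elim: u => [|x u /= ->]; rewrite ?add0r ?addrA. Qed.

Lemma heights_cat u v :
  heights (u ++ v) = heights u ++ [seq (y.1, asum u + y.2) | y <- heights v].
Proof.
elim: u => [|[[] e] u IHu] /=.
- by rewrite map_id_in // => -[y n] _ /=; rewrite add0r.
- by rewrite IHu add0r.
- by rewrite IHu map_cat -!map_comp; congr (_ ++ _); apply: eq_map => y /=; rewrite addrA.
Qed.

Lemma asum_bpow c : asum (bpow c) = 0.
Proof. by rewrite /bpow; elim: `|c|%N => //= n ->; rewrite addr0. Qed.

Lemma hsum_bpow (V : zmodType) (theta : int -> V) c : hsum theta (heights (bpow c)) = theta 0 *~ c.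
Proof.
rewrite /bpow {3}(_ : c = `|c|%N%:Z * lsign (true, 0 <= c)); last first.
  by rewrite /lsign /=; case: (lerP 0 c) => H; lia.
elim: `|c|%N => [|n IHn] /=; first by rewrite mul0r mulr0z /hsum big_nil.
by rewrite hsum_cons IHn /= intS mulrDl mul1r mulrzDr.
Qed.

(** This is a word for [e_(j+1)], as conjugation by [a] is multiplication by [X]. *)
Fixpoint basis_word (m : int) (r : nat -> int) (j : nat) : word :=
  if j is j'.+1 then aw ++ basis_word m r j' ++ bpow (- r j') ++ Aw
  else aw ++ bpow m ++ Aw.

Lemma asum_basis_word m r j : asum (basis_word m r j) = 0.
Proof. by elim: j => [|j IHj] /=; rewrite !asum_cat ?IHj asum_bpow. Qed.

Lemma hsum_basis_word m r (V : zmodType) (theta : int -> V) j k :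
  hsum (fun n => theta (k + n)) (heights (basis_word m r j)) = basis_value m r theta j k.
Proof.
have conj w c i : asum w = 0 -> hsum (fun n => theta (i + n)) (heights (aw ++ w ++ bpow c ++ Aw))
    = hsum (fun n => theta (i + 1 + n)) (heights w) + theta (i + 1) *~ c.
  move=> w0; rewrite !heights_cat !(hsum_cat, hsum_shift) w0 hsum_bpow.
  have -> : asum aw = 1 by [].
  rewrite [hsum _ [::]]big_nil ?[hsum _ [::]]big_nil add0r !addr0; congr (_ + _).
  by apply: eq_hsum => n; rewrite addrA.
elim: j k => [|j IHj] k /=.
  by have := conj [::] m k erefl; rewrite /= {2}/hsum big_nil add0r.
by rewrite conj ?asum_basis_word // IHj mulrNz.
Qed.

(** * The Heisenberg representation given by the inverse power series *)

Section InverseSeries.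
Variables (m : int) (r : nat -> int).
Hypothesis m0 : m != 0.

(** The whole list is carried along because the recursion refers to all earlier coefficients. *)
Fixpoint inv_coefs (n : nat) : seq rat :=
  if n is n'.+1 then
    rcons (inv_coefs n') ((\sum_(i < n) (inv_coefs n')`_(n' - i) * (r i)%:~R) / m%:~R)
  else [:: m%:~R^-1].

(* Coefficients of the formal inverse of the power series [m - \sum_i r_i S^(i+1)]. *)
Definition inv_coef (n : nat) : rat := (inv_coefs n)`_n.

Lemma size_inv_coefs n : size (inv_coefs n) = n.+1.
Proof. by elim: n => //= n IHn; rewrite size_rcons IHn. Qed.

Lemma inv_coefsE n i : (i <= n)%N -> (inv_coefs n)`_i = inv_coef i.
Proof.
elim: n => [|n IHn]; first by rewrite leqn0 => /eqP ->.
rewrite leq_eqVlt => /orP[/eqP -> //|]; rewrite ltnS => ilen.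
by rewrite /= nth_rcons size_inv_coefs ltnS ilen IHn.
Qed.

Lemma inv_coef0 : inv_coef 0 = m%:~R^-1. Proof. by []. Qed.

Lemma inv_coefS n : inv_coef n.+1 * m%:~R = \sum_(i < n.+1) inv_coef (n - i) * (r i)%:~R.
Proof.
rewrite /inv_coef /= nth_rcons size_inv_coefs ltnn eqxx divfK ?intr_eq0 //.
by apply: eq_bigr => i _; rewrite inv_coefsE // leq_subr.
Qed.

Definition lam (k : int) : rat := if k is Posz j.+1 then inv_coef j else 0.
Definition mu (k : int) : rat := (k == 0)%:R.

Lemma lam_le0 (k : int) : k <= 0 -> lam k = 0.
Proof. by case: k => [[|n]|n]. Qed.

Lemma lam_mu k : lam k * mu k = 0.
Proof. by rewrite /mu; case: eqP => [->|_]; rewrite ?mul0r ?mulr0. Qed.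

(** This is the product of the series and its inverse, read coefficient by coefficient; the terms
    where [lam] has a nonpositive argument drop out. *)
Lemma basis_value_lam j (k : int) : k <= 0 -> basis_value m r lam j k = (k + j%:Z == 0)%:R.
Proof.
move=> k0; rewrite basis_valueE; case: (ltP (k + j%:Z) 0) => kj.
  rewrite lam_le0 ?mul0rz ?sub0r ?big1 ?oppr0 => [|i _|]; try lia.
    by case: eqP => // e; lia.
  by rewrite lam_le0 ?mul0rz //; lia.
have [N NE] : exists N : nat, k + j%:Z = N by exists (absz (k + j%:Z)%R); lia.
have Nj : (N <= j)%N by lia.
rewrite NE; have -> : N%:Z + 1 = N.+1 by lia.
rewrite -(subnKC Nj) big_split_ord /= [X in _ - (_ + X)]big1 ?addr0 => [|i _]; last first.
  by rewrite lam_le0 ?mul0rz //; lia.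
rewrite /= -mulrzr; case: N {NE Nj} => [|N].
  by rewrite big_ord0 subr0 inv_coef0 mulVf ?intr_eq0.
rewrite inv_coefS; apply/eqP; rewrite subr_eq0; apply/eqP; apply: eq_bigr => i _.
have -> : N.+1%:Z - i%:Z = (N - i).+1 by have := ltn_ord i; lia.
by rewrite mulrzr.
Qed.

(** For [k <= 0] both factors are integers. For [k > 0] only positive exponents occur, where [mu] is
    zero. *)
Lemma lattice_value_int (k : int) f g :
  lattice_value m r mu k f * lattice_value m r lam k g \is a Num.int.
Proof.
have mu_int j : mu j \is a Num.int by rewrite rpred_nat.
have sum_int (W : nat -> rat) (t : seq int) (h : forall i, W i \is a Num.int) :
    \sum_(i < size t) W i *~ t`_i \is a Num.int.
  by apply: rpred_sum => i _; apply: rpredMz.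
case: (lerP k 0) => k0.
  apply: rpredM; rewrite /lattice_value rpredD ?rpredMz // ?lam_le0 ?rpred0 //.
    apply: (sum_int (fun i => basis_value m r mu i k)) => i.
    by rewrite basis_valueE rpredB ?rpredMz // rpred_sum // => j _; apply: rpredMz.
  by apply: (sum_int (fun i => basis_value m r lam i k)) => i; rewrite basis_value_lam ?rpred_nat.
have mu0 (j : int) : 0 < j -> mu j = 0 by rewrite /mu lt0r => /andP[/negPf ->].
rewrite /lattice_value mu0 // mul0rz add0r big1 ?mul0r ?rpred0 // => i _.
rewrite basis_valueE mu0 ?mul0rz; last lia.
rewrite big1 ?subr0 ?mul0rz // => j _; rewrite mu0 ?mul0rz //.
by have := ltn_ord j; lia.
Qed.

Lemma heis_kernel w s : lim_kernel m r w -> heis_eq (run (heis_act lam mu) w s) s.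
Proof. exact: (lim_kernel_model (heis_model lam_mu lattice_value_int)). Qed.

End InverseSeries.

(** * Isomorphisms *)

Definition bw : word := [:: (true, true)].

Definition subst_letter (A B : word) (x : letter) : word :=
  let U := if x.1 then B else A in if x.2 then U else invw U.

Definition subst (A B w : word) : word := flatten (map (subst_letter A B) w).

Lemma subst_cat A B u v : subst A B (u ++ v) = subst A B u ++ subst A B v.
Proof. by rewrite /subst map_cat flatten_cat. Qed.

Lemma subst_cons A B x u : subst A B (x :: u) = subst_letter A B x ++ subst A B u.
Proof. by []. Qed.

Lemma asum_invw u : asum (invw u) = - asum u.
Proof.
by elim: u => [|[[] []] u IHu] //; rewrite invw_cons asum_cat IHu /= /lsign /=; lia.
Qed.

Lemma asum_subst A B w :
  asum (subst A B w) = asum w * asum A + asum B * hsum (fun _ => 1) (heights w).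
Proof.
elim: w => [|x w IHw]; first by rewrite /hsum big_nil /=; lia.
rewrite subst_cons asum_cat IHw; case: x => [[] e] /=; rewrite ?hsum_cons ?hsum_shift /=.
  by case: e; rewrite /lsign /subst_letter /= ?asum_invw; lia.
by case: e; rewrite /lsign /subst_letter /= ?asum_invw; lia.
Qed.

(** The second clause makes every model a representation of the quotient; the third provides the
    relations that a homomorphism transports. *)
Definition limit_congruence (m : int) (r : nat -> int) (E : word -> word -> Prop) : Prop :=
  [/\ word_congruence E, forall w, E w [::] <-> lim_kernel m r w
    & forall j, E (bw ++ basis_word m r j) (basis_word m r j ++ bw)].

(* A surjective homomorphism between the quotients, given by the images of [a] and [b]
   and by preimages of [a] and [b]. *)
Definition epimorphic (E1 E2 : word -> word -> Prop) : Prop :=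
  exists A B ua ub : word,
    [/\ forall u v, E1 u v -> E2 (subst A B u) (subst A B v),
        E2 (subst A B ua) aw & E2 (subst A B ub) bw].

Section Epimorphism.
Variables (K : fieldType) (X : K).
Hypothesis X_free : forall p : {poly int}, (map_poly intr p).[X] = 0 -> p = 0.
Variables (m1 m2 : int) (r1 r2 : nat -> int) (E1 E2 : word -> word -> Prop).
Hypotheses (m10 : m1 != 0) (m20 : m2 != 0).
Hypotheses (lim1 : limit_congruence m1 r1 E1) (lim2 : limit_congruence m2 r2 E2).

Let X0 : X != 0 := transcendental_neq0 X_free.

Notation aff := (run (affine_act X)).
Notation heis := (run (heis_act (lam m2 r2) mu)).

Lemma congr_action T (V : T -> Prop) (eqT : T -> T -> Prop) (act : letter -> T -> T) u v st :
  letter_action V act -> (forall w s, V s -> lim_kernel m2 r2 w -> eqT (run act w s) s) ->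
  V st -> E2 u v -> eqT (run act u st) (run act v st).
Proof.
case: lim2 => congE kerE _ aP ker Vst uv.
have /kerE/(ker _ (run act v st) (run_valid aP _ Vst)) : E2 (u ++ invw v) [::].
  apply: (congr_trans congE) (congr_invwr congE v).
  exact: (congr_cat congE) uv (congr_refl congE _).
by rewrite run_cat (run_invwl aP).
Qed.

Lemma congr_affine u v y : E2 u v -> aff u y = aff v y.
Proof.
apply: (congr_action (affine_action X0)) => // w s _.
exact: (lim_kernel_model (affine_model X0 m2 r2)).
Qed.

Lemma congr_heis u v s : E2 u v -> heis_eq (heis u s) (heis v s).
Proof.
apply: (congr_action (V := fun _ => True)) => // [|w {}s _]; last exact: heis_kernel.
by split=> // l {}s _; apply: heis_actK; apply: lam_mu.
Qed.

(** The values at 0 and 1 determine the translation and the linear part, and the latter determines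
    the exponent sum since [X] has infinite order. *)
Lemma affine_inj u v : (forall y, aff u y = aff v y) ->
  asum u = asum v /\ hsum (fun n => X ^ n) (heights u) = hsum (fun n => X ^ n) (heights v).
Proof.
move=> uv; have h : hsum (fun n => X ^ n) (heights u) = hsum (fun n => X ^ n) (heights v).
  by have := uv 0; rewrite !run_affine // !mulr0 !add0r.
split=> //; have := uv 1; rewrite !run_affine // h !mulr1 => /addIr e.
apply/eqP; rewrite -subr_eq0; apply/eqP/(laurent_exp_eq1 X_free).
by rewrite expfzDr // e -expfzDr // addrN expr0z.
Qed.

Lemma affine_fix_uniq u y z : asum u != 0 -> aff u y = y -> aff u z = z -> y = z.
Proof.
move=> u0; rewrite !run_affine //; set h := hsum _ _ => yE zE.
have : (X ^ asum u - 1) * (y - z) = 0.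
  have -> : (X ^ asum u - 1) * (y - z) = (X ^ asum u * y + h - y) - (X ^ asum u * z + h - z).
    by ring.
  by rewrite yE zE !subrr.
move/eqP; rewrite mulf_eq0 !subr_eq0 => /orP[/eqP/(laurent_exp_eq1 X_free)/eqP|/eqP //].
by rewrite (negPf u0).
Qed.

Lemma affine_fix_ex u : asum u != 0 -> exists y, aff u y = y.
Proof.
move=> u0; have Xu : 1 - X ^ asum u != 0.
  rewrite subr_eq0; apply: contra u0 => /eqP e.
  by apply/eqP/(laurent_exp_eq1 X_free).
exists (hsum (fun n => X ^ n) (heights u) / (1 - X ^ asum u)).
by rewrite run_affine //; field.
Qed.

Variables (A B ua ub : word).
Hypothesis homE : forall u v, E1 u v -> E2 (subst A B u) (subst A B v).
Hypotheses (surA : E2 (subst A B ua) aw) (surB : E2 (subst A B ub) bw).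

Lemma subst_fix y w : aff A y = y -> aff B y = y -> aff (subst A B w) y = y.
Proof.
have actP := affine_action X0.
move=> Ay By; elim: w => // x w IHw; rewrite subst_cons run_cat IHw.
have inv u : aff u y = y -> aff (invw u) y = y.
  by move=> uy; rewrite -{1}uy (run_invwl actP).
by case: x => [[] []]; rewrite /subst_letter /= ?inv.
Qed.

(* Otherwise B, hence also its conjugate ABA^-1, some power of which commutes with B,
   and A itself, would have the same fixed point in the affine action. *)
Lemma asum_b_eq0 : asum B = 0.
Proof.
have actP := affine_action X0.
apply/eqP/negP => /negP B0; have [y By] := affine_fix_ex B0.
set D := subst A B (basis_word m1 r1 0); set W := subst A B (bpow m1).
have W0 : asum W = asum B * m1.
  rewrite asum_subst asum_bpow mul0r add0r hsum_bpow; lia.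
have bwE : subst A B bw = B by rewrite /subst /= cats0.
have DE : D = A ++ W ++ invw A.
  by rewrite /D /= -cat1s !subst_cat /subst /= !cats0.
have D0 : asum D != 0.
  by rewrite DE !asum_cat asum_invw W0 addrCA addrN addr0 mulf_neq0.
have comm z : aff B (aff D z) = aff D (aff B z).
  have /congr_affine e : E2 (B ++ D) (D ++ B).
    case: lim1 => _ _ /(_ 0%N)/homE.
    by rewrite (subst_cat _ _ bw) (subst_cat _ _ (basis_word m1 r1 0) bw) bwE.
  by rewrite -!run_cat e.
have Dy : aff D y = y by apply: (affine_fix_uniq B0) => //; rewrite comm By.
have Wy : aff W y = y.
  rewrite /W /bpow; elim: `|m1|%N => //= n IHn; rewrite subst_cons run_cat IHn.
  by case: (0 <= m1); rewrite /subst_letter //= -{1}By (run_invwl actP).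
have DAy : aff D (aff A y) = aff A y by rewrite DE !run_cat (run_invwl actP) // Wy.
have Ay : aff A y = y by apply: (affine_fix_uniq D0).
(* A point fixed by [A] and [B] is fixed by the whole image, hence by [a], which fixes only 0; but
   [b] moves 0 to 1. *)
have y0 : y = 0.
  apply: (@affine_fix_uniq aw) => //=; last by rewrite /affine_act /= mulr0.
  by rewrite -[RHS](subst_fix ua Ay By) (congr_affine _ surA).
have := subst_fix ub Ay By; rewrite (congr_affine _ surB) y0 /affine_act /= add0r.
by move/eqP; rewrite (negPf (oner_neq0 K)).
Qed.

Lemma asum_subst_b w : asum (subst A B w) = asum w * asum A.
Proof. by rewrite asum_subst asum_b_eq0 mul0r addr0. Qed.

Lemma asum_a_sign : asum A = 1 \/ asum A = -1.
Proof.
have [+ _] := affine_inj (fun y => congr_affine y surA).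
rewrite asum_subst_b /= /lsign /= addr0 => /(congr1 absz); rewrite abszM => /eqP.
by rewrite muln_eq1 => /andP[_ /eqP]; lia.
Qed.

(** Relative to the fixed point [y] of [A], the word [A] acts as multiplication by [X^d] and [B] as
    a translation; this computes how far the image of [w] moves [y]. *)
Lemma laurent_subst w : asum w = 0 ->
  hsum (fun n => X ^ n) (heights (subst A B w)) =
  hsum (fun n => X ^ n) (heights B) * hsum (fun n => X ^ (asum A * n)) (heights w).
Proof.
have actP := affine_action X0.
have A0 : asum A != 0 by case: asum_a_sign => ->.
have [y Ay] := affine_fix_ex A0.
set d := asum A; set pB := hsum _ (heights B).
have AE z : aff A (y + z) = y + X ^ d * z.
  by rewrite -{2}Ay !run_affine //; ring.
have AVE z : aff (invw A) (y + z) = y + X ^ (- d) * z.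
  rewrite -[RHS](run_invwl actP A) // AE mulrA -expfzDr // addrN expr0z mul1r.
  by [].
have BE z : aff B z = z + pB.
  by rewrite run_affine // asum_b_eq0 expr0z mul1r.
have BVE z : aff (invw B) z = z - pB.
  by rewrite -[RHS](run_invwl actP B) // BE subrK.
have wE u : aff (subst A B u) y = y + pB * hsum (fun n => X ^ (d * n)) (heights u).
  elim: u => [|x u IHu]; first by rewrite /hsum /= big_nil mulr0 addr0.
  rewrite subst_cons run_cat IHu; case: x => [[] e] /=.
    rewrite hsum_cons /= mulr0 expr0z mulrDr mulrzAr mulr1.
    case: e; rewrite /subst_letter /= ?BE ?BVE /lsign /= ?mulrN1z -addrA; congr (_ + _);
      by rewrite addrC.
  rewrite hsum_shift.
  have shift j : hsum (fun n => X ^ (d * (j + n))) (heights u)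
      = X ^ (d * j) * hsum (fun n => X ^ (d * n)) (heights u).
    rewrite /hsum mulr_sumr; apply: eq_bigr => z _.
    by rewrite mulrDr expfzDr // mulrzAr.
  rewrite shift mulrCA.
  by case: e; rewrite /subst_letter /lsign /= ?AE ?AVE ?mulr1 ?mulrN1.
move=> w0; apply: (addrI y); rewrite -wE run_affine // asum_subst_b w0 mul0r.
by rewrite expr0z mul1r.
Qed.

(** Writing [b] in terms of [A] and [B] exhibits an inverse of the translation part of [B]. *)
Lemma laurent_b : exists eps l, (eps = 1 \/ eps = -1) /\
  hsum (fun n => X ^ n) (heights B) = eps%:~R * X ^ l.
Proof.
have [b0 hb] := affine_inj (fun y => congr_affine y surB).
have ub0 : asum ub = 0.
  by move: b0; rewrite asum_subst_b /=; case: asum_a_sign => ->; lia.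
have : hsum (fun n => X ^ n) (heights B) *
    hsum (fun n => X ^ n) [seq (y.1, asum A * y.2) | y <- heights ub] = 1.
  by rewrite {2}/hsum big_map -laurent_subst // hb /hsum big_seq1.
exact: laurent_unit.
Qed.

(** Both words have exponent sum zero in [a], so they preserve the fibre. The expression is the
    difference of the last coordinates of the two products, up to sign. *)
Lemma commutator_int w k : asum w = 0 ->
  (forall s, heis_eq (heis (B ++ subst A B w) s) (heis (subst A B w ++ B) s)) ->
  hsum (fun n => mu (k + n)) (heights B)
    * hsum (fun n => lam m2 r2 (k + n)) (heights (subst A B w))
  - hsum (fun n => mu (k + n)) (heights (subst A B w))
    * hsum (fun n => lam m2 r2 (k + n)) (heights B)
  \is a Num.int.
Proof.
move=> w0 /(_ (k, (0, 0))); rewrite !run_cat.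
have [C1 e1] := run_heis (lam m2 r2) mu B k.
have [C2 e2] := run_heis (lam m2 r2) mu (subst A B w) k.
move: e1 e2; rewrite asum_subst_b w0 asum_b_eq0 mul0r subr0 => e1 e2.
rewrite e1 e2 e1 e2 => -[_ _ /=].
set U1 := hsum _ (heights B); set V1 := hsum _ (heights B).
set U2 := hsum _ _; set V2 := hsum _ (heights (subst A B w)).
by congr (_ \is a _); ring.
Qed.

Lemma epimorphism_digits : (m2 %| m1)%Z /\
  ((forall j, basis_value m1 r1 (lam m2 r2) j 0 \is a Num.int) \/ forall i, (m2 %| r1 i)%Z).
Proof.
have [eps [l [e pB]]] := laurent_b.
have hB (V : zmodType) (theta : int -> V) : hsum theta (heights B) = theta l *~ eps.
  rewrite (laurent_eq X_free (l' := [:: (eps, l)])) /hsum ?big_seq1 //=.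
  by rewrite -[LHS]/(hsum _ _) pB mulrzl.
have hw (V : zmodType) (theta : int -> V) j :
    hsum theta (heights (subst A B (basis_word m1 r1 j)))
    = hsum (fun n => theta (l + asum A * n)) (heights (basis_word m1 r1 j)) *~ eps.
  pose f (y : int * int) := (y.1 * eps, l + asum A * y.2).
  have fE (W : zmodType) (t : int -> W) u :
      hsum t (map f u) = hsum (fun n => t (l + asum A * n)) u *~ eps.
    by rewrite /hsum big_map mulrz_suml; apply: eq_bigr => y _; rewrite /= mulrzA.
  rewrite -fE; apply: (laurent_eq X_free); rewrite fE laurent_subst ?asum_basis_word //.
  rewrite pB -[RHS]mulrzl -mulrA; congr (_ * _); rewrite /hsum mulr_sumr.
  by apply: eq_bigr => y _; rewrite expfzDr // mulrzAr.
have bwE : subst A B bw = B by rewrite /subst /= cats0.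
have comm j k : (mu (k + l) *~ eps) *
    (hsum (fun n => lam m2 r2 (k + (l + asum A * n))) (heights (basis_word m1 r1 j)) *~ eps)
  - (hsum (fun n => mu (k + (l + asum A * n))) (heights (basis_word m1 r1 j)) *~ eps)
    * (lam m2 r2 (k + l) *~ eps) \is a Num.int.
  have e2 : E2 (B ++ subst A B (basis_word m1 r1 j)) (subst A B (basis_word m1 r1 j) ++ B).
    case: lim1 => _ _ /(_ j)/homE.
    by rewrite (subst_cat _ _ bw) (subst_cat _ _ (basis_word m1 r1 j) bw) bwE.
  have := commutator_int k (asum_basis_word m1 r1 j) (fun s => congr_heis s e2).
  by rewrite !hB !hw.
have sign_int (x : rat) : x *~ eps \is a Num.int -> x \is a Num.int.
  by case: e => ->; rewrite // mulrN1z rpredN.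
have dvd_int (n : int) : inv_coef m2 r2 0 *~ n \is a Num.int -> (m2 %| n)%Z.
  rewrite inv_coef0 -mulrzr => /intrP[z /(congr1 ( *%R m2%:~R))].
  rewrite mulVKf ?intr_eq0 // -intrM => /intr_inj ->; exact: dvdz_mulr.
(* If the sign is 1, the fibre [- l] gives [mu 0 = 1] and [lam 0 = 0], so only the first product
   survives. *)
case: asum_a_sign => dE; rewrite dE in comm.
  have bint j : basis_value m1 r1 (lam m2 r2) j 0 \is a Num.int.
    have := comm j (- l); rewrite addNr (_ : mu 0 = 1) // lam_le0 // mul0rz mulr0 subr0.
    rewrite mulrzAr => /sign_int; rewrite mulrzAl mul1r => /sign_int.
    rewrite -(hsum_basis_word m1 r1 (lam m2 r2)); congr (_ \is a _).
    by apply: eq_hsum => n; rewrite mul1r addKr add0r.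
  split; last by left.
  by apply: dvd_int; have := bint 0%N.
(* If the sign is -1, the fibre [1 - l] has [mu 1 = 0] and [lam 1 = 1 / m2]. What remains is the
   coefficient of [X] in [e_(j+1)], namely [m1] for [j = 0] and [- r_i] for [j = i + 1], divided by
   [m2]. *)
have bint j : inv_coef m2 r2 0 *~ basis_value m1 r1 (fun n => (n == 1)%:R) j 0 \is a Num.int.
  have := comm j (1 - l); rewrite subrK {1}/mu mul0rz mul0r sub0r rpredN.
  rewrite -[lam m2 r2 1]/(inv_coef m2 r2 0) mulrzAr => /sign_int; rewrite mulrzAl => /sign_int.
  rewrite -(hsum_basis_word m1 r1 (fun n => (n == 1)%:R)) -mulrzl; congr (_ * _ \is a _).
  rewrite /hsum rmorph_sum; apply: eq_bigr => y _ /=.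
  rewrite rmorphMz /= rmorph_nat /mu; congr ((nat_of_bool _)%:R *~ _).
  by rewrite mulN1r addrA subrK subr_eq0 eq_sym add0r.
split; first by apply: dvd_int; have := bint 0%N; rewrite -[basis_value _ _ _ _ _]/(1 *~ m1) intz.
right=> i; apply: dvd_int; have := bint i.+1; rewrite basis_valueE big_ord_recr /=.
rewrite big1 => [|j _].
  have -> : (0 + i.+1%:Z + 1 == 1) = false by lia.
  have -> : 0 + i.+1%:Z - i%:Z == 1 by lia.
  by rewrite mul0rz !add0r -[true%:R *~ _]/(1 *~ r1 i) intz mulrNz rpredN.
have -> : (0 + i.+1%:Z - j%:Z == 1) = false by have := ltn_ord j; lia.
by rewrite mul0rz.
Qed.

End Epimorphism.

(** This supplies the field and the transcendental element for the affine representation. *)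
Lemma fraction_polyX_free (p : {poly int}) :
  (map_poly intr p).[FracField.tofrac 'X] = 0 :> {fraction {poly int}} -> p = 0.
Proof.
have -> : map_poly intr p = map_poly (@FracField.tofrac {poly int}) (map_poly polyC p).
  rewrite -map_poly_comp; apply: eq_map_poly => c /=.
  by rewrite -[c in RHS]intz [_%:P]rmorph_int rmorph_int.
rewrite horner_map -[(map_poly polyC p).['X]]/(p \Po 'X) comp_polyXr => /eqP.
by rewrite tofrac_eq0 => /eqP.
Qed.

Lemma epimorphic_digit_eq (m1 m2 : int) (r1 r2 : nat -> int) E1 E2 : 0 < m1 -> 0 < m2 ->
  (forall i, 0 <= r1 i < m1) -> (forall i, 0 <= r2 i < m2) ->
  limit_congruence m1 r1 E1 -> limit_congruence m2 r2 E2 ->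
  epimorphic E1 E2 -> epimorphic E2 E1 -> m1 = m2 /\ forall i, r1 i = r2 i.
Proof.
move=> m1p m2p r1b r2b lim1 lim2 [A1 [B1 [ua1 [ub1 [hom1 sa1 sb1]]]]].
move=> [A2 [B2 [ua2 [ub2 [hom2 sa2 sb2]]]]].
have m10 : m1 != 0 by rewrite gt_eqF.
have m20 : m2 != 0 by rewrite gt_eqF.
have [d21 c1] := epimorphism_digits fraction_polyX_free m10 m20 lim1 lim2 hom1 sa1 sb1.
have [d12 c2] := epimorphism_digits fraction_polyX_free m20 m10 lim2 lim1 hom2 sa2 sb2.
have mE : m1 = m2.
  rewrite -(gtz0_abs m1p) -(gtz0_abs m2p); congr Posz.
  by apply/eqP; rewrite eqn_dvd; apply/andP.
subst m2; split=> //.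
have small (x : int) : (m1 %| x)%Z -> - m1 < x < m1 -> x = 0.
  case/dvdzP=> q ->; rewrite -mulN1r ltr_pM2r // -[X in _ && (_ < X)]mul1r ltr_pM2r // => q1.
  by rewrite (_ : q = 0) ?mul0r; lia.
(* If the digits below [n] agree, the value for [u] differs from the zero value for [v] by
   [(v n - u n) / m1]. Its integrality and the bounds on digits force equality. *)
have int_case (u v : nat -> int) : (forall i, 0 <= u i < m1) -> (forall i, 0 <= v i < m1) ->
    (forall j, basis_value m1 u (lam m1 v) j 0 \is a Num.int) -> forall i, u i = v i.
  move=> ub vb uint i; elim/ltn_ind: i => n IHn.
  have vint : basis_value m1 v (lam m1 v) n.+1 0 = 0 by rewrite basis_value_lam.
  have : basis_value m1 u (lam m1 v) n.+1 0 - basis_value m1 v (lam m1 v) n.+1 0 \is a Num.int.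
    by rewrite vint subr0.
  rewrite !basis_valueE !big_ord_recr /=.
  set S := \sum_(i < n) _; set S' := \sum_(i < n) _.
  have -> : S' = S by apply: eq_bigr => i _; rewrite IHn.
  have -> : 0 + n.+1%:Z - n%:Z = 1 by lia.
  rewrite (_ : lam m1 v 1 = m1%:~R^-1) //; set q := (X in X *~ m1).
  have -> : q *~ m1 - (S + m1%:~R^-1 *~ u n) - (q *~ m1 - (S + m1%:~R^-1 *~ v n))
     = m1%:~R^-1 *~ (v n - u n) by rewrite mulrzBr; ring.
  rewrite -mulrzr => /intrP[z /(congr1 ( *%R m1%:~R))].
  rewrite mulVKf ?intr_eq0 // -intrM => /intr_inj e.
  have := small (v n - u n); rewrite e dvdz_mulr // -e => /(_ isT).
  by have := ub n; have := vb n; lia.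
case: c1 => [/int_case|c1]; first exact.
(* When integrality fails to be available in both directions, [m1] divides all digits of both
   sequences, so all of them are zero. *)
case: c2 => [/int_case H i|c2 i]; first by rewrite H.
have zero_case (u : nat -> int) j : (forall i, 0 <= u i < m1) -> (m1 %| u j)%Z -> u j = 0.
  move=> ub /small; apply; case/andP: (ub j) => u0 ->.
  by rewrite andbT (lt_le_trans _ u0) ?oppr_lt0.
by rewrite (zero_case r1 i r1b (c1 i)) (zero_case r2 i r2b (c2 i)).
Qed.

(** * The limit of Baumslag-Solitar groups as a quotient by a congruence *)

Section LimitOfBS.
Variables (m : int) (xi : nat -> int) (N : word -> Prop).
Hypothesis m0 : m != 0.

(** The sign replaces [(m, xi)] by a pair with positive first entry; the digit of index [i] is
    determined at level [i + 1]. *)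
Definition limit_digit (m : int) (xi : nat -> int) (i : nat) : int :=
  digit `|m|%N (Num.sg m * xi i.+1) i.

Lemma limit_digit_bound i : 0 <= limit_digit m xi i < `|m|%N%:Z.
Proof. by rewrite modz_ge0 ?ltz_pmod //; lia. Qed.

Hypothesis barN : is_barBS m xi N.

Lemma limit_congruence_ex : exists E, limit_congruence `|m|%N (limit_digit m xi) E /\
  forall w, N (wreduce w) <-> E w [::].
Proof.
case: barN => s [s_inf [s_conv N_conv]].
set M := `|m|%N%:Z; have M0 : M != 0 by rewrite /M; lia.
set r := limit_digit m xi.
pose s' n := Num.sg m * s n.
have sgE : Num.sg m = 1 \/ Num.sg m = -1 by case: sgrP m0; auto.
have s'_inf : tends_infty s'.
  move=> B; have [L HL] := s_inf B; exists L => n /HL.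
  by rewrite /s' abszM; case: sgE => ->; rewrite mul1n.
have s'_digit i : eventually (fun n => digit M (s' n) i = r i).
  have [L HL] := s_conv i.+1; exists L => n /HL; rewrite eqz_mod_dvd => d.
  by apply: digit_congr => //; rewrite /s' -mulrBr dvdz_mull.
pose P n := bsP M (s' n); pose K n := bsK M (s' n).
have PE n e : P n e = Num.sg m * (if e then m else s n).
  by rewrite /P /bsP; case: e; rewrite // /M abszE normrEsg.
have s'0 := eventually_neq0 s'_inf.
have KP n : s' n != 0 -> forall e (c : int), K n e (c + P n e) = K n e c + 1.
  by move=> sn0; apply: bsKP.
have K0 n : s' n != 0 -> forall e, K n e 0 = 0 by move=> sn0; apply: bsK0.
pose E u v := eventually (fun n => forall st, normal_state (K n) st ->
   run (bs_act (P n) (K n)) u st = run (bs_act (P n) (K n)) v st).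
have congE : word_congruence E.
  split.
  - by move=> u; exists 0%N.
  - by move=> u v; apply: eventually_mono => n uv st nst; rewrite uv.
  - by move=> u v w; apply: eventually_and2 => n uv vw st nst; rewrite uv ?vw.
  - move=> u u' v v' uu vv; apply: eventually_and2 (eventually_and uu vv) s'0.
    move=> n [{}uu {}vv] sn0 st nst; rewrite !run_cat vv // uu //.
    exact: (run_valid (bs_action (KP n sn0) (K0 n sn0))).
  - move=> x; apply: eventually_mono s'0 => n sn0 st nst.
    have := (proj2 (bs_action (KP n sn0) (K0 n sn0))) (lflip x) st nst.
    by rewrite lflipK.
have kerE w : lim_kernel M r w <-> eventually (fun n => BSker m (s n) (wreduce w)).
  rewrite (lim_kernelP M0 s'_inf s'_digit w).
  split=> wE; apply: eventually_and2 wE s'0 => n wn sn0.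
    exact/(BSker_runE sgE (PE n) (KP n sn0) (K0 n sn0)).
  exact/(BSker_runE sgE (PE n) (KP n sn0) (K0 n sn0)).
have EkerE w : E w [::] <-> eventually (fun n => BSker m (s n) (wreduce w)).
  split=> wE.
    by apply/kerE/(lim_kernelP M0 s'_inf s'_digit); apply: eventually_mono wE => n ->.
  apply: eventually_and2 wE s'0 => n wn sn0 st nst.
  rewrite -(run_wreduce (bs_action (KP n sn0) (K0 n sn0))) //.
  exact: (BSker_run sgE (PE n) (KP n sn0) (K0 n sn0)).
exists E; split.
  split=> // [w|j]; first by rewrite EkerE kerE.
  (* For large [n], the word for [e_(j+1)] acts as a power of [b], and thus commutes with [b]. *)
  have wordE : eventually (fun n => forall c l, normal_stack (K n) l ->
      run (bs_act (P n) (K n)) (basis_word M r j) (c, l) = (c + s' n * digit_s M (s' n) j, l)).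
    have dig := eventually_ltn j s'_digit.
    apply: eventually_and2 dig s'0 => n dig sn0.
    have conjE w k x : (forall c l, normal_stack (K n) l ->
          run (bs_act (P n) (K n)) w (c, l) = (c + M * k - x, l)) ->
        forall c l, normal_stack (K n) l ->
        run (bs_act (P n) (K n)) (aw ++ w ++ bpow x ++ Aw) (c, l) = (c + s' n * k, l).
      move=> wE c l nl; rewrite !run_cat run_bpow [run _ Aw _]/= /bs_act /=.
      have := bs_step_normal (KP n sn0) false (nl : normal_state (K n) (c, l)).
      have := bs_stepK (KP n sn0) (K0 n sn0) false (nl : normal_state (K n) (c, l)).
      case: (bs_step _ _ false (c, l)) => c1 l1 stE nl1 /=; rewrite wE //.
      have -> : c1 + x + M * k - x = c1 + P n true * k by rewrite -[P n true]/M; ring.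
      by rewrite (bs_step_shift (KP n sn0)) stE.
    elim: j dig => [|j IHj] dig.
      by apply: (conjE [::] 1 M) => c l _ /=; rewrite mulr1 addrK.
    apply: (conjE (basis_word M r j) (digit_s M (s' n) j.+1)) => c l nl.
    rewrite IHj // => [|i ij]; last by apply: dig; apply: ltnW.
    by rewrite digit_sE dig // opprK addrA.
  apply: eventually_mono wordE => n wE [c l] nl.
  by rewrite !run_cat [run _ bw _]/= /bs_act /= !wE //= addrAC.
move=> w; rewrite EkerE.
have [L HL] := N_conv (size (wreduce w)); split=> [Nw|[L' HL']].
  by exists L => n Ln; apply/(HL n Ln) => //; apply: wreduceK.
apply/(HL (maxn L L')) => //; rewrite ?leq_maxl //; first exact: wreduceK.
by apply: HL'; apply: leq_maxr.
Qed.

End LimitOfBS.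

Section QuotientIso.
Variables (N1 N2 : word -> Prop) (E1 E2 : word -> word -> Prop).
Hypotheses (cong1 : word_congruence E1) (cong2 : word_congruence E2).
Hypotheses (NE1 : forall w, N1 (wreduce w) <-> E1 w [::]).
Hypotheses (NE2 : forall w, N2 (wreduce w) <-> E2 w [::]).

Lemma quotientE N E (congE : word_congruence E) (NE : forall w, N (wreduce w) <-> E w [::]) u v :
  N (wmul (winv u) v) <-> E u v.
Proof. by rewrite -(congr_quotient congE) -NE /wmul wreduceK. Qed.

(** The map [f] is multiplicative only modulo [E2]; there it agrees with substituting [f aw] and
    [f bw]. Preimages of the generators define the inverse substitution. *)
Lemma quot_iso_epimorphic : quot_iso N1 N2 -> epimorphic E1 E2 /\ epimorphic E2 E1.
Proof.
case=> f [f_hom [f_mul [f_inj f_surj]]].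
have Q1 := quotientE cong1 NE1; have Q2 := quotientE cong2 NE2.
have fE u v : E1 u v -> E2 (f u) (f v) by move/Q1/f_hom/Q2.
have fV u v : E2 (f u) (f v) -> E1 u v by move/Q2/f_inj/Q1.
have fM u v : E2 (f (u ++ v)) (f u ++ f v).
  apply: (congr_trans cong2 (v := f (wmul u v))); last first.
    have /Q2 fuv := f_mul u v; exact: (congr_trans cong2 fuv (congr_wreduce cong2 _)).
  by apply/fE/(congr_sym cong1)/(congr_wreduce cong1).
have f1 : E2 (f [::]) [::].
  apply: (congr_trans cong2 (v := invw (f [::]) ++ f [::] ++ f [::])).
    rewrite -[X in E2 X _]cat0s catA; apply: (congr_cat cong2) (congr_refl cong2 _).
    exact/(congr_sym cong2)/(congr_invwl cong2).
  apply: (congr_trans cong2) (congr_invwl cong2 (f [::])).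
  by apply: (congr_cat cong2 (congr_refl cong2 _)); apply/(congr_sym cong2)/(fM [::] [::]).
have fI u : E2 (f (invw u)) (invw (f u)).
  apply: (congr_trans cong2 (v := f (invw u) ++ f u ++ invw (f u))).
    rewrite -{1}[f (invw u)]cats0; apply: (congr_cat cong2 (congr_refl cong2 _)).
    exact/(congr_sym cong2)/(congr_invwr cong2).
  rewrite catA -[X in E2 _ X]cat0s; apply: (congr_cat cong2) (congr_refl cong2 _).
  apply: (congr_trans cong2) f1; apply: (congr_trans cong2 (congr_sym cong2 (fM _ _))).
  exact/fE/(congr_invwl cong1).
have fS A B w : (forall x, E2 (f (subst_letter A B x)) (subst_letter (f A) (f B) x)) ->
    E2 (f (subst A B w)) (subst (f A) (f B) w).
  move=> fx; elim: w => [|x w IHw]; first exact: f1.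
  by rewrite !subst_cons; apply: (congr_trans cong2 (fM _ _)); apply: (congr_cat cong2).
have fL A B x : E2 (f (subst_letter A B x)) (subst_letter (f A) (f B) x).
  case: x => [[] []]; by [exact: (congr_refl cong2) | exact: fI].
have subst_id w : subst aw bw w = w.
  by elim: w => //= x w; rewrite subst_cons => ->; case: x => [[] []].
have [ua /Q2 uaE] := f_surj aw; have [ub /Q2 ubE] := f_surj bw.
have fsubst w : E2 (subst (f aw) (f bw) w) (f w).
  by rewrite -{2}[w]subst_id; apply/(congr_sym cong2)/fS.
have gK w : E2 (f (subst ua ub w)) w.
  apply: (congr_trans cong2 (fS _ _ _ (fL _ _))).
  rewrite -[X in E2 _ X]subst_id; elim: w => [|x w IHw]; first exact: (congr_refl cong2).
  rewrite !subst_cons; apply: (congr_cat cong2) IHw.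
  by case: x => [[] []]; rewrite /subst_letter //=; apply: (congr_invw cong2).
split.
  exists (f aw), (f bw), ua, ub; split=> [u v uv||].
  - apply: (congr_trans cong2 (fsubst _)); apply: (congr_trans cong2 (fE _ _ uv)).
    exact/(congr_sym cong2)/fsubst.
  - exact: (congr_trans cong2 (fsubst _)).
  - exact: (congr_trans cong2 (fsubst _)).
exists ua, ub, (f aw), (f bw); split=> [u v uv||]; apply: fV.
- apply: (congr_trans cong2 (gK _)); apply: (congr_trans cong2 uv).
  exact/(congr_sym cong2)/gK.
- exact: gK.
- exact: gK.
Qed.

End QuotientIso.

Lemma eq_lim_run (m : int) (r r' : nat -> int) w : r =1 r' -> lim_run m r w = lim_run m r' w.
Proof.
move=> rr; have dotE t : edot r t = edot r' t by apply: eq_bigr => i _; rewrite rr.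
elim: w => // x w; rewrite /lim_run /= => ->; rewrite /lim_act; case: ifP => // _.
rewrite /lim_step /lim_quo /lim_rem dotE.
by case: (_.1.2) => // t0 t; rewrite dotE.
Qed.

Lemma quot_iso_digits (m m' : int) (xi xi' : nat -> int) (N N' : word -> Prop) :
  m != 0 -> m' != 0 -> is_barBS m xi N -> is_barBS m' xi' N' ->
  (quot_iso N N' <->
   `|m|%N = `|m'|%N /\ forall i, limit_digit m xi i = limit_digit m' xi' i).
Proof.
move=> m0 m'0 barN barN'.
have [E [limE NE]] := limit_congruence_ex m0 barN.
have [E' [limE' NE']] := limit_congruence_ex m'0 barN'.
have cE : word_congruence E by case: limE.
have cE' : word_congruence E' by case: limE'.
split=> [iso|[mm rr]].
  have [e12 e21] := quot_iso_epimorphic cE cE' NE NE' iso.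
  have mp : 0 < `|m|%N%:Z by rewrite ltz_nat absz_gt0.
  have mp' : 0 < `|m'|%N%:Z by rewrite ltz_nat absz_gt0.
  have [/eqP mm rr] := epimorphic_digit_eq mp mp' (limit_digit_bound xi m0)
    (limit_digit_bound xi' m'0) limE limE' e12 e21.
  by split=> //; apply/eqP.
(* Equal digits give equal kernels, so the identity on words is an isomorphism. *)
have NN w : N (wreduce w) <-> N' (wreduce w).
  rewrite NE NE'; case: limE limE' => _ -> _ [_ -> _].
  by rewrite /lim_kernel mm (eq_lim_run _ _ rr).
have refl u : N' (wmul (winv u) u) by apply/(quotientE cE' NE'); apply: (congr_refl cE').
exists id; split=> [u v /NN //|]; split=> [u v|]; first exact: refl.
by split=> [u v /NN //|v]; exists v; apply: refl.
Qed.

(** * Digits and greatest common divisors *)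

Lemma digit_s_scale (d m y : int) i : 0 < d -> digit_s (d * m) (d * y) i = digit_s m y i.
Proof. by move=> d0; elim: i => //= i ->; rewrite -mulrA divzMpl. Qed.

Lemma digit_scale (d m y : int) i : 0 < d -> digit (d * m) (d * y) i = d * digit m y i.
Proof. by move=> d0; rewrite /digit digit_s_scale // -mulrA mulz_modr. Qed.

(** Coprimality makes the digits faithful: they all vanish, for instance, as soon as [m] divides
    [y]. *)
Lemma digit_inj (m y y' : int) k : coprimez m y' ->
  (forall i, (i < k)%N -> digit m y i = digit m y' i) -> (m ^+ k %| y - y')%Z.
Proof.
move=> cop dig; case: k dig => [|k] dig; first by rewrite expr0 dvd1z.
have dE i : (i < k.+1)%N -> m * (digit_s m y i.+1 - digit_s m y' i.+1)
    = y * digit_s m y i - y' * digit_s m y' i by move=> ik; rewrite !digit_sE dig //; ring.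
(* The recurrences for [y] and [y'] telescope; [D] is a power of [y'] modulo [m], hence invertible
   there. *)
have [D [DE copD]] : exists D,
    (y - y') * D = m ^+ k.+1 * (digit_s m y k.+1 - digit_s m y' k.+1) /\ coprimez m D.
  elim: k dE {dig} => [|k IHk] dE.
    by exists 1; rewrite expr1 dE // !mulr1; split=> //; rewrite /coprimez gcdz1.
  have [|D [DE copD]] := IHk; first by move=> i ik; apply: dE; apply: ltnW.
  exists (m ^+ k.+1 * digit_s m y k.+1 + y' * D); split.
    rewrite (exprSr _ k.+1) -mulrA dE // mulrDr [_ * (y' * D)]mulrCA DE; ring.
  rewrite /coprimez exprS -mulrA [m * _]mulrC gcdzMDl -/(coprimez _ _).
  by rewrite coprimezMr cop.
by rewrite -(@Gauss_dvdzl _ _ D) ?coprimez_pexpl // DE dvdz_mulr.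
Qed.

Lemma adic_dvd M xi k : is_adic M xi -> (M%:Z %| xi k.+1 - xi 1%N)%Z.
Proof.
move=> ad; elim: k => [|k IHk]; first by rewrite subrr dvdz0.
have -> : xi k.+2 - xi 1%N = (xi k.+2 - xi k.+1) + (xi k.+1 - xi 1%N) by ring.
rewrite rpredD //; have := ad k.+1; rewrite eqz_mod_dvd; apply: dvdz_trans.
by rewrite exprS dvdz_mulr.
Qed.

(* The shift of indices makes the quotient a coherent sequence. *)
Lemma adic_div (M : nat) (x : nat -> int) (d : int) : d != 0 -> (d %| M%:Z)%Z ->
  is_adic M x -> (forall k, (d %| x k.+1)%Z) ->
  is_adic M (fun k => x k.+1 %/ d)%Z /\ adic_eq M (fun k => d * (x k.+1 %/ d)%Z) x.
Proof.
move=> d0 dM ad dx; split=> k; last first.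
  by rewrite mulrC divzK //; apply: ad.
rewrite eqz_mod_dvd -(@dvdz_mul2l d _ _ d0) mulrBr ![d * (_ %/ _)%Z]mulrC !divzK //.
by have := ad k.+1; rewrite eqz_mod_dvd; apply: dvdz_trans; rewrite exprS dvdz_mul.
Qed.

(** As [m] divides [xi - xi 1], the ideal is generated by the integers [m] and [xi 1], for which a
    Bezout identity is available. *)
Lemma adic_gcd (m : int) (xi : nat -> int) : m != 0 -> is_adic `|m|%N xi ->
  is_adic_gcd m xi (gcdz m (xi 1%N)).
Proof.
move=> m0 ad; set M := `|m|%N; set d := gcdz m (xi 1%N).
have dp : 0 < d by rewrite lt_def gcdz_eq0 negb_and m0.
have d0 : d != 0 by rewrite gt_eqF.
have dm : (d %| m)%Z by apply: dvdz_gcdl.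
have dM : (d %| M%:Z)%Z by rewrite dvdzE.
have mM : (m %| M%:Z)%Z by rewrite dvdzE.
have dx k : (d %| xi k.+1)%Z.
  rewrite -[xi k.+1](subrK (xi 1%N)) rpredD ?dvdz_gcdr //.
  exact: dvdz_trans dM (adic_dvd k ad).
split=> //; split=> // z adz.
have adD x y : is_adic M x -> is_adic M y -> is_adic M (fun k => x k + y k).
  move=> ax ay k; have := ax k; have := ay k; rewrite !eqz_mod_dvd opprD addrACA => ? ?.
  by rewrite rpredD.
have adM x y : is_adic M x -> is_adic M y -> is_adic M (fun k => x k * y k).
  move=> ax ay k; have := ax k; have := ay k; rewrite !eqz_mod_dvd => yk xk.
  have -> : x k.+1 * y k.+1 - x k * y k
    = (x k.+1 - x k) * y k.+1 + x k * (y k.+1 - y k) by ring.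
  by apply: rpredD; [apply: dvdz_mulr|apply: dvdz_mull].
have adC c : is_adic M (fun=> c) by [].
split=> [[a [b [aad [bad zE]]]]|[c [cad zE]]].
  have [ead etaE] := adic_div d0 dM ad dx.
  exists (fun k => (m %/ d)%Z * a k + (xi k.+1 %/ d)%Z * b k); split.
    exact: (adD _ _ (adM _ _ (adC _) aad) (adM _ _ ead bad)).
  move=> k; apply/eqP; rewrite (eqP (zE k)) mulrDr !mulrA [d * (m %/ d)%Z]mulrC divzK //.
  apply/eqP; rewrite eqz_mod_dvd.
  have -> : m * a k + xi k * b k - (m * a k + d * (xi k.+1 %/ d)%Z * b k)
    = - (d * (xi k.+1 %/ d)%Z - xi k) * b k by ring.
  by have := etaE k; rewrite eqz_mod_dvd => e; rewrite dvdz_mulr // rpredN.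
have [u [v uv]] := Bezoutz m (xi 1%N).
(* The Bezout identity involves [xi 1]; replacing it by [xi] changes the coefficient of [m] by
   [v * x / m]. *)
pose x k := xi 1%N - xi k.
have adx : is_adic M x.
  move=> k; have := ad k; rewrite !eqz_mod_dvd /x => ?.
  have -> : xi 1%N - xi k.+1 - (xi 1%N - xi k) = - (xi k.+1 - xi k) by ring.
  by rewrite rpredN.
have mx k : (m %| x k.+1)%Z by rewrite /x -opprB rpredN; apply: dvdz_trans mM (adic_dvd k ad).
have [tad tE] := adic_div m0 mM adx mx.
exists (fun k => (u + v * (x k.+1 %/ m)%Z) * c k), (fun k => v * c k); split.
  by apply: (adM _ c) => //; apply: (adD (fun=> u)) => //; apply: (adM (fun=> v)).
split; first exact: (adM (fun=> v)).
move=> k; rewrite (eqP (zE k)) eqz_mod_dvd.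
have -> : d * c k - (m * ((u + v * (x k.+1 %/ m)%Z) * c k) + xi k * (v * c k))
  = - (m * (x k.+1 %/ m)%Z - x k) * (v * c k) by rewrite /d -uv /x; ring.
by have := tE k; rewrite eqz_mod_dvd => e; rewrite dvdz_mulr // rpredN.
Qed.

Lemma limit_digit_divisor (m d : int) (xi eta : nat -> int) i : m != 0 -> 0 < d -> (d %| m)%Z ->
  adic_eq `|m|%N (fun k => d * eta k) xi ->
  limit_digit m xi i = d * digit (`|m|%N %/ `|d|%N)%N (Num.sg m * eta i.+1) i.
Proof.
move=> m0 dp dm etaE.
have mE : `|m|%N%:Z = d * (`|m|%N %/ `|d|%N)%N%:Z.
  by rewrite -{1}(gtz0_abs dp) -PoszM mulnC divnK.
rewrite -digit_scale // -mE mulrCA; apply: digit_congr; first by lia.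
have := etaE i.+1; rewrite eqz_mod_dvd -mulrBr => e.
by rewrite dvdz_mull // -opprB rpredN.
Qed.

Theorem theoremC (m m' : int) (xi xi' : nat -> int) (N N' : word -> Prop) :
  m != 0 -> m' != 0 ->
  is_adic `|m|%N xi -> is_adic `|m'|%N xi' ->
  is_barBS m xi N -> is_barBS m' xi' N' ->
  (quot_iso N N' <->
   exists (eps d : int),
     (eps = 1 \/ eps = -1) /\ 0 < d /\
     m = eps * m' /\
     is_adic_gcd m xi d /\ is_adic_gcd m' xi' d /\
     exists eta eta' : nat -> int,
       is_adic `|m|%N eta /\ adic_eq `|m|%N (fun k => d * eta k) xi /\
       is_adic `|m'|%N eta' /\ adic_eq `|m'|%N (fun k => d * eta' k) xi' /\
       adic_eq (`|m|%N %/ `|d|%N) eta (fun k => eps * eta' k)).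
Proof.
move=> m0 m'0 ad ad' barN barN'; rewrite (quot_iso_digits m0 m'0 barN barN').
have sg2 (x : int) : x != 0 -> Num.sg x = 1 \/ Num.sg x = -1 by case: sgrP; auto.
have mul_sg (x : int) : x != 0 -> Num.sg x * Num.sg x = 1 by move=> /sg2[] ->.
split=> [[mm rr]|[eps [d [epsE [dp [mE [[_ [dm _]] [[_ [dm' _]] [eta [eta' eta_spec]]]]]]]]]]; last first.
  have [_ [etaE [_ [etaE' ee]]]] := eta_spec.
  have mm : `|m|%N = `|m'|%N by rewrite mE abszM; case: epsE => ->; rewrite mul1n.
  split=> // i; rewrite (limit_digit_divisor _ m0 dp dm etaE).
  rewrite (limit_digit_divisor _ m'0 dp dm' etaE').
  rewrite -mm; congr (_ * _); apply: digit_congr.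
    by rewrite -lt0n divn_gt0 ?absz_gt0 ?gt_eqF // dvdn_leq ?absz_gt0.
  have -> : Num.sg m' = Num.sg m * eps.
    rewrite mE sgrM; case: epsE => ->; rewrite ?sgr1 ?sgrN1; ring.
  rewrite -mulrA -mulrBr dvdz_mull //; have := ee i.+1; rewrite eqz_mod_dvd; exact.
set M := `|m|%N in mm *.
have mE : m = Num.sg m * M%:Z by rewrite abszE -numEsg.
(* The first digit is the first level of the adic integer modulo [M], up to sign, so the digits
   determine the gcd. *)
have gcdE (x : int) (z : nat -> int) : x != 0 -> M = `|x|%N ->
    gcdz x (z 1%N) = gcdz M (limit_digit x z 0).
  move=> x0 xM; rewrite /limit_digit /digit -xM mulr1 gcdz_modr /gcdz abszM xM.
  by case: (sg2 _ x0) => ->; rewrite mul1n.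
have dE : gcdz m (xi 1%N) = gcdz m' (xi' 1%N) by rewrite !gcdE // rr.
pose d := gcdz m (xi 1%N).
have gcd : is_adic_gcd m xi d by apply: adic_gcd.
have gcd' : is_adic_gcd m' xi' d by rewrite /d dE; apply: adic_gcd.
have [dp [dm _]] := gcd; have [_ [dm' _]] := gcd'.
have d0 : d != 0 by rewrite gt_eqF.
exists (Num.sg m * Num.sg m'), d.
split; first by case: (sg2 _ m0) (sg2 _ m'0) => -> [->|->]; auto.
split=> //; split; first by rewrite -mulrA -normrEsg -abszE -mm.
do 2!split=> //.
have dM : (d %| M%:Z)%Z by rewrite dvdzE.
have dx (z : nat -> int) k : is_adic M z -> (d %| z 1%N)%Z -> (d %| z k.+1)%Z.
  move=> az d1; rewrite -[z k.+1](subrK (z 1%N)) rpredD //.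
  exact: dvdz_trans dM (adic_dvd k az).
have [etaA etaE] := adic_div d0 dM ad (fun k => dx xi k ad (dvdz_gcdr _ _)).
rewrite -mm in ad' *.
have d1' : (d %| xi' 1%N)%Z by rewrite /d dE dvdz_gcdr.
have [etaA' etaE'] := adic_div d0 dM ad' (fun k => dx xi' k ad' d1').
exists (fun k => xi k.+1 %/ d)%Z, (fun k => xi' k.+1 %/ d)%Z; do 4!split=> //.
set eta := (fun k => xi k.+1 %/ d)%Z in etaA etaE *.
set eta' := (fun k => xi' k.+1 %/ d)%Z in etaA' etaE' *.
move=> k; rewrite eqz_mod_dvd; set mu := (M %/ `|d|%N)%N.
have MdE : M%:Z = d * mu%:Z by rewrite -{1}(gtz0_abs dp) -PoszM mulnC divnK.
suff H : (mu%:Z ^+ k %| Num.sg m * eta k - Num.sg m' * eta' k)%Z.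
  have -> : eta k - Num.sg m * Num.sg m' * eta' k
     = Num.sg m * (Num.sg m * eta k - Num.sg m' * eta' k) by rewrite mulrBr !mulrA mul_sg // mul1r.
  exact: dvdz_mull.
have muM : (mu%:Z %| M%:Z)%Z by rewrite MdE dvdz_mull.
have adic_le (z : nat -> int) i j : is_adic M z -> (i <= j)%N -> (mu%:Z ^+ i %| z j - z i)%Z.
  move=> az /subnKC <-; elim: (j - i)%N => [|n IHn]; first by rewrite addn0 subrr dvdz0.
  rewrite addnS.
  have -> : z (i + n).+1 - z i = (z (i + n).+1 - z (i + n)%N) + (z (i + n)%N - z i) by ring.
  rewrite rpredD //; have := az (i + n)%N; rewrite eqz_mod_dvd; apply: dvdz_trans.
  by apply: dvdz_trans (dvdz_exp2r _ muM); rewrite exprD dvdz_mulr.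
have mu0 : mu%:Z != 0 by apply: contraNneq m0 => e; rewrite mE MdE e !mulr0.
have level (x : int) (z e : nat -> int) i : x != 0 -> `|x|%N = M -> (d %| x)%Z -> is_adic M e ->
    adic_eq M (fun k => d * e k) z -> (i < k)%N ->
    limit_digit x z i = d * digit mu (Num.sg x * e k) i.
  move=> x0 xM dx' ae ez ik; rewrite (@limit_digit_divisor x d z e i) ?xM //.
  congr (_ * _); apply: digit_congr => //; rewrite -mulrBr dvdz_mull //.
  by rewrite -opprB rpredN; apply: adic_le.
apply: digit_inj => [|i ik]; last first.
  apply: (mulfI d0); rewrite -(level m xi eta) // -(level m' xi' eta') //.
(* Here [d * gcd(mu, xi' / d) = gcd(M, xi') = d]. *)
have cop : coprimez mu (eta' k).
  have : d * gcdz mu (eta' k) = d * 1.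
    rewrite -{1}(gtz0_abs dp) mulz_gcdr -MdE /eta' mulrC divzK; last exact: dx.
    rewrite mulr1 -[xi' _](subrK (xi' 1%N)).
    have /dvdzP[q ->] := adic_dvd k ad'.
    by rewrite gcdzMDl /d dE /gcdz -mm.
  by move/(mulfI d0) => e; rewrite /coprimez e.
by rewrite coprimezMr cop andbT; case: (sg2 _ m'0) => ->; rewrite /coprimez ?gcdzN gcdz1.
Qed.
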